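(* Let $k\ge1$ and let $g$ be a $C^k$ function defined on an interval $I$. Let $X$ be an $n\times n$ real symmetric matrix with all eigenvalues in $I$, and let $V$ be an orthogonal matrix such that $X=V(\mathrm{Diag}\,\lambda(X))V^T$. Then the matrix valued function $G$ associated with $g$ is $C^k$ at $X$, and $$\nabla^kG(X)=V\Big(\sum_{\sigma\in\tilde P^{k+1}}\mathrm{Diag}^\sigma\,\mathbf{g}(\lambda(X))\Big)V^T .$$
   Context: $S^n$ is the space of $n\times n$ real symmetric matrices, with $\langle X,Y\rangle=\mathrm{tr}(XY^T)$. For $X\in S^n$, $\lambda(X)$ is the vector of eigenvalues of $X$ in nonincreasing order. $\mathrm{Diag}\,x$ is the diagonal matrix with diagonal $x$. The function $G$: for a symmetric $X$ with eigenvalues in $I$ and an orthogonal $V$ with $X=V(\mathrm{Diag}\,\lambda(X))V^T$, $G(X)=V\,\mathrm{Diag}\big(g(\lambda_1(X)),\dots,g(\lambda_n(X))\big)V^T$ (this does not depend on the choice of $V$). $T^{k,n}$ is the space of $k$-tensors on $\mathbb{R}^n$ (multilinear maps $(\mathbb{R}^n)^k\to\mathbb{R}$), with entries $T^{i_1\dots i_k}$. $\tilde P^{s}$ is the set of permutations of $\{1,\dots,s\}$ having exactly one cycle (the $s$-cycles). For $T\in T^{k,n}$ and a permutation $\sigma$ of $\{1,\dots,k\}$, $\mathrm{Diag}^\sigma T$ is the $2k$-tensor whose entry with upper indices $i_1,\dots,i_k$ and lower indices $j_1,\dots,j_k$ equals $T^{i_1\dots i_k}$ if $i_r=j_{\sigma(r)}$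 for all $r$, and $0$ otherwise. A $2k$-tensor is viewed as a $k$-linear form on matrices by $T[H_1,\dots,H_k]=\sum T^{\substack{p_1\dots p_k\\ q_1\dots q_k}}H_1^{p_1q_1}\cdots H_k^{p_kq_k}$ (sum over all $p_r,q_r\in\{1,\dots,n\}$). For an $m$-tensor $T$ and orthogonal $V$, $(VTV^T)^{i_1\dots i_m}=\sum_{p_1,\dots,p_m}T^{p_1\dots p_m}V^{i_1p_1}\cdots V^{i_mp_m}$ (for $2k$-tensors it is applied to all $2k$ indices). The derivative $\nabla^kG(X)$, a $k$-linear map from $S^n$ to $S^n$, is identified with the $(k+1)$-linear form $\nabla^kG(X)[H_1,\dots,H_{k+1}]=\langle\nabla^kG(X)[H_1,\dots,H_k],H_{k+1}\rangle$ on $S^n$, and the formula is an equality of $(k+1)$-linear forms on $S^n$. For $x,y\in\mathbb{R}^s$ let $V(x_1,\dots,x_s)$ be the Vandermonde determinant of the $s\times s$ matrix with rows $(x_1^{s-1},\dots,x_s^{s-1}),\dots,(x_1,\dots,x_s),(1,\dots,1)$, so $V(x_1,\dots,x_s)=\prod_{j<i}(x_j-x_i)$, and let $V\big(\substack{y_1,\dots,y_s\\ x_1,\dots,x_s}\big)$ be the determinant of the matrix obtained from it by replacing the first row by $(y_1,\dots,y_s)$. For $g\in C^k(I)$ the function $$(x_1,\dots,x_{k+1})\mapsto \frac{V\big(\substack{g(x_1),\dots,g(x_{k+1})\\ x_1,\dots,x_{k+1}}\big)}{V(x_1,\dots,x_{k+1})},$$ defined for points of $I^{k+1}$ with distinct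 coordinates, extends continuously to all of $I^{k+1}$. The $(k+1)$-tensor valued map $\mathbf{g}$ is defined for $\mu\in I^n$ by letting $\big(\mathbf{g}(\mu)\big)^{i_1\dots i_{k+1}}$ be the value of this continuous extension at $(\mu_{i_1},\dots,\mu_{i_{k+1}})$. *)

(* Defs.v *)
From HB Require Import structures.
From mathcomp Require Import all_boot all_order all_algebra all_fingroup.
From mathcomp Require Import all_classical all_reals all_analysis.

Set Implicit Arguments.
Unset Strict Implicit.
Unset Printing Implicit Defensive.

Import Order.TTheory GRing.Theory Num.Theory.
Import numFieldNormedType.Exports.

Local Open Scope classical_set_scope.
Local Open Scope ring_scope.

Section Spectral.
Context {R : realType} {n : nat}.
Implicit Types (X Y V : 'M[R]_n) (I : set R) (g : R -> R).

Definition sym_mx X : Prop := X^T = X.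

Definition orth_mx V : Prop := V *m V^T = 1%:M.

Definition is_eigvals X (l : 'rV[R]_n) : Prop :=
  char_poly X = \prod_(i < n) ('X - (l 0 i)%:P) /\
  (forall i j : 'I_n, (i <= j)%N -> l 0 j <= l 0 i).

(* Junk value 0 when X does not have n real eigenvalues; at most one l
   satisfies the predicate. *)
Definition eigvals X : 'rV[R]_n := xget 0 [set l | is_eigvals X l].

Definition diagonalizes V X : Prop :=
  orth_mx V /\ X = V *m diag_mx (eigvals X) *m V^T.

Definition eigbasis X : 'M[R]_n := xget 1%:M [set V | diagonalizes V X].

Definition matrix_fun g X : 'M[R]_n :=
  eigbasis X *m diag_mx (map_mx g (eigvals X)) *m (eigbasis X)^T.

Definition sym_spectrum_in I : set 'M[R]_n :=
  [set X | sym_mx X /\ forall i, I (eigvals X 0 i)].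

End Spectral.

(* Derivatives at points of I are taken within I, so they are one-sided at an
   endpoint of I belonging to I. *)
Definition Ck_on {R : realType} (I : set R) (k : nat) (g : R -> R) : Prop :=
  exists d : nat -> R -> R,
    [/\ forall x, I x -> d 0%N x = g x,
        forall j, (j < k)%N -> forall x, I x ->
          (fun y => (d j y - d j x) / (y - x)) @ within I x^' --> d j.+1 x
      & {within I, continuous (d k)}].

Section MatrixDerivatives.
Context {R : realType} {n : nat}.
Implicit Types (D : set 'M[R]_n) (F : 'M[R]_n -> 'M[R]_n) (X Y Z : 'M[R]_n).

(* (H_1, ..., H_j, Z) *)
Definition extend_args j (H : 'I_j -> 'M[R]_n) Z : 'I_j.+1 -> 'M[R]_n :=
  fun i => if unlift ord_max i is Some i' then H i' else Z.

(* M restricts to a j-linear map from S^n to S^n; its values on non-symmetric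
   arguments are irrelevant everywhere below. *)
Definition sym_multilinear j (M : ('I_j -> 'M[R]_n) -> 'M[R]_n) : Prop :=
  (forall H, (forall i, sym_mx (H i)) -> sym_mx (M H)) /\
  (forall (H : 'I_j -> 'M[R]_n) (i : 'I_j) (a : R) (A B : 'M[R]_n),
     (forall l, sym_mx (H l)) -> sym_mx A -> sym_mx B ->
     M [eta H with i |-> a *: A + B] =
       a *: M [eta H with i |-> A] + M [eta H with i |-> B]).

(* Frechet differentiability at Y, relative to D, of the map P from D to the
   space of j-linear maps on S^n with the operator norm; the derivative
   direction is the last argument of dP. *)
Definition frechet_within D j (P : 'M[R]_n -> ('I_j -> 'M[R]_n) -> 'M[R]_n) Y
    (dP : ('I_j.+1 -> 'M[R]_n) -> 'M[R]_n) : Prop :=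
  forall eps : R, 0 < eps -> \forall Z \near within D (nbhs Y),
    forall H, (forall i, sym_mx (H i)) ->
      `|P Z H - P Y H - dP (extend_args H (Z - Y))|
        <= eps * `|Z - Y| * \prod_(i < j) `|H i|.

Definition continuous_within D j
    (P : 'M[R]_n -> ('I_j -> 'M[R]_n) -> 'M[R]_n) Y : Prop :=
  forall eps : R, 0 < eps -> \forall Z \near within D (nbhs Y),
    forall H, (forall i, sym_mx (H i)) ->
      `|P Z H - P Y H| <= eps * \prod_(i < j) `|H i|.

(* P j Y is the j-th derivative at Y of F : D -> S^n, for all Y in D close to X
   and all j <= k, and the k-th one is continuous there. *)
Definition derivatives_near D F k X
    (P : forall j, 'M[R]_n -> ('I_j -> 'M[R]_n) -> 'M[R]_n) : Prop :=
  \forall Y \near within D (nbhs X),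
    [/\ forall H, P 0%N Y H = F Y,
        forall j, (j <= k)%N -> sym_multilinear (P j Y),
        forall j, (j < k)%N -> frechet_within D (P j) Y (P j.+1 Y)
      & continuous_within D (P k) Y].

Definition Ck_at D F k X : Prop := exists P, derivatives_near D F k X P.

(* The derivative is unique on symmetric arguments when D is a convex set with
   nonempty interior in S^n, or is open in S^n. *)
Definition nabla D F k X : ('I_k -> 'M[R]_n) -> 'M[R]_n :=
  xget (fun=> 0) [set M | exists2 P, derivatives_near D F k X P & P k X = M].

(* The (k+1)-linear form <M[H_1, ..., H_k], H_{k+1}>. *)
Definition as_form k (M : ('I_k -> 'M[R]_n) -> 'M[R]_n)
    (H : 'I_k.+1 -> 'M[R]_n) : R :=
  \tr (M (fun i => H (lift ord_max i)) *m (H ord_max)^T).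

End MatrixDerivatives.
Arguments Ck_at {R n} D F k X.
Arguments nabla {R n} D F k X H.

Section Tensors.
Context {R : realType} {n : nat}.

Definition tensor s := {ffun 'I_s -> 'I_n} -> R.

(* 2s-tensors: upper multi-index first, lower multi-index second. *)
Definition tensor2 s := {ffun 'I_s -> 'I_n} -> {ffun 'I_s -> 'I_n} -> R.

Definition Diag_perm s (sigma : 'S_s) (T : tensor s) : tensor2 s :=
  fun i j => if [forall r, i r == j (sigma r)] then T i else 0.

Definition one_cycle s (sigma : 'S_s) : bool := #|porbits sigma| == 1%N.

Definition sum_cycles s (T : tensor s) : tensor2 s :=
  fun i j => \sum_(sigma : 'S_s | one_cycle sigma) Diag_perm sigma T i j.

Definition conj_tensor2 s (V : 'M[R]_n) (T : tensor2 s) : tensor2 s :=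
  fun i j => \sum_(p : {ffun 'I_s -> 'I_n}) \sum_(q : {ffun 'I_s -> 'I_n})
    T p q * (\prod_(r < s) V (i r) (p r)) * (\prod_(r < s) V (j r) (q r)).

Definition tensor2_form s (T : tensor2 s) (H : 'I_s -> 'M[R]_n) : R :=
  \sum_(p : {ffun 'I_s -> 'I_n}) \sum_(q : {ffun 'I_s -> 'I_n})
    T p q * \prod_(r < s) H r (p r) (q r).

End Tensors.
Arguments tensor : clear implicits.
Arguments tensor2 : clear implicits.

Section DividedDifferences.
Context {R : realType}.

(* Decreasing powers: the first row is x_j ^ (s - 1), the last one is 1. *)
Definition vandermonde s (x : 'rV[R]_s) : R :=
  \det (\matrix_(i < s, j < s) x 0 j ^+ (s - i.+1)).

Definition vandermonde_first_row s (y x : 'rV[R]_s) : R :=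
  \det (\matrix_(i < s, j < s)
          if i == 0%N :> nat then y 0 j else x 0 j ^+ (s - i.+1)).

Definition cube (I : set R) s : set 'rV[R]_s := [set x | forall i, I (x 0 i)].

Arguments cube : clear implicits.

Definition is_continuous_extension (I : set R) (g : R -> R) s
    (E : 'rV[R]_s -> R) : Prop :=
  {within cube I s, continuous E} /\
  (forall x, cube I s x -> injective (x 0) ->
     E x = vandermonde_first_row (map_mx g x) x / vandermonde x).

(* When I is an interval with more than one point the continuous extension, if
   it exists, is unique on the cube. *)
Definition vandermonde_quotient (I : set R) (g : R -> R) s : 'rV[R]_s -> R :=
  xget (fun=> 0) [set E | is_continuous_extension I g E].

Definition bold_g (I : set R) (g : R -> R) k n (mu : 'rV[R]_n)
    : tensor R n k.+1 :=
  fun i => vandermonde_quotient I g (\row_(r < k.+1) mu 0 (i r)).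

End DividedDifferences.
Arguments bold_g {R} I g k {n} mu _.

(* Main.v *)
From HB Require Import structures.
Require Import Defs.
From mathcomp Require Import all_boot all_order all_algebra all_fingroup.
From mathcomp Require Import all_classical all_reals all_analysis.
From mathcomp Require Import ring lra.
From mathcomp Require complex.

Set Implicit Arguments.
Unset Strict Implicit.
Unset Printing Implicit Defensive.

Import Order.TTheory GRing.Theory Num.Theory.
Import numFieldNormedType.Exports.

Local Open Scope classical_set_scope.
Local Open Scope ring_scope.

(** Let [Y] be symmetric with eigenvalues in [I]. Once the spectral theorem provides
    an orthonormal eigenbasis of [Y], write [P] for the projection onto one of its
    vectors and [l] for the eigenvalue. To a function [f] of [j + 1] real variables
    and symmetric matrices [Y_0, ..., Y_j] one attaches the multilinear map

      [M_f(Y_0, ..., Y_j)[H_1, ..., H_j] =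
         sum f(l_0, ..., l_j) P_0 H_1 P_1 H_2 ... H_j P_j],

    the sum being over all choices of an eigenprojection [P_r] of [Y_r] with
    eigenvalue [l_r]. For [j = 0] and [f = g] this is the matrix function [G].

    If [P] is an eigenprojection of [Z] for [l] and [P'] one of [Y] for [l'], then
    [P (Z - Y) P' = (l - l') P P'] (eigenproj_difference). Hence, when [psi] is the
    divided difference of [f] in its r-th variable, exchanging [Z] for [Y] in the
    r-th slot of [M_f] changes its value by [M_psi] with [Z] and [Y] in neighbouring
    slots and [Z - Y] as argument between them (chain_head). This is an identity and
    not an approximation. Exchanging the slots one after the other (chain_telescope)
    writes the increment of the j-th candidate derivative, the sum of
    [M(Y, ..., Y)[H_s(1), ..., H_s(j)]] over all orders [s], in terms of the next
    divided difference, and the candidate of order [j + 1] appears as soon as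
    [M_psi] is continuous in its slots.

    That continuity uses the same relation a second time: [P P'] is at most of the
    size of [Z - Y] divided by [l - l'], so only pairs of close eigenvalues matter,
    and for these the values of [psi] are close (chain_uniformly_continuous,
    chain_continuous). Eigenvectors are never followed.

    The divided differences of [g] of order at most [k] extend continuously and
    symmetrically to all of [I^(k+1)]. At a point with two different coordinates the
    recursion expresses them through lower ones; at a constant point [(c, ..., c)] a
    mean value theorem, [g[x_0, ..., x_j] = g^(j)(xi) / j!], does the rest
    (divdiff_mean_value, divdiff_limit_exists). Distinct coordinates being dense, the
    recursion and the symmetry pass to the extension, and it agrees with the extension
    of the quotient of Vandermonde determinants (vandermonde_quotient_ext).

    The derivatives are unique, because the symmetric matrices with spectrum in [I]
    form a convex set that contains a ball around a scalar matrix
    (derivatives_unique).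

    Finally, pairing the k-th derivative with [H_(k+1)] closes each product of
    projections to a loop, and the trace of a loop is a sum over closed paths of
    matrix indices. An order [s] of [H_1, ..., H_k], closed up by [H_(k+1)], is the
    same thing as a (k+1)-cycle (orbit_list_perm); by the symmetry of the divided
    difference, the loop is then the summand of that cycle in the tensor formula
    (cycle_trace, trace_sum_cycles). *)


(** * Divided differences at distinct nodes *)

Section DividedDifferenceAlgebra.
Variable F : fieldType.
Implicit Types (f h : F -> F) (s t : seq F).

(** Lagrange's form, on a list of nodes: its symmetry is a mere permutation of the
    summands. *)
Definition divdiff f s : F :=
  \sum_(x <- s) f x / \prod_(y <- s | y != x) (x - y).

Lemma perm_divdiff f s t : perm_eq s t -> divdiff f s = divdiff f t.
Proof.
move=> st; rewrite /divdiff (perm_big _ st) /=.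
by apply: eq_bigr => x _; rewrite (perm_big _ st).
Qed.

Lemma divdiff_cons f x t : uniq (x :: t) ->
  divdiff f (x :: t) = f x / \prod_(y <- t) (x - y) +
    \sum_(z <- t) f z / ((z - x) * \prod_(y <- t | y != z) (z - y)).
Proof.
move=> /= /andP[xt ut]; rewrite /divdiff big_cons; congr (_ / _ + _).
  rewrite big_cons eqxx big_seq_cond [RHS]big_seq_cond; apply: eq_bigl => y.
  by rewrite andbT; case: (boolP (y \in t)) => //= yt; apply: contraNneq xt => <-.
rewrite big_seq [RHS]big_seq; apply: eq_bigr => z zt.
by rewrite big_cons; case: eqP => // xz; rewrite xz zt in xt.
Qed.

(** In the coefficient of [f z] the factors [z - x'] and [z - x] that distinguish
    the two divided differences on the right differ by [x - x']. *)
Lemma divdiff_rec f x x' t : uniq (x :: x' :: t) ->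
  (x - x') * divdiff f (x :: x' :: t) = divdiff f (x :: t) - divdiff f (x' :: t).
Proof.
move=> u; have /= /andP[] := u; rewrite inE negb_or => /andP[xx' xt] /andP[x't ut].
rewrite (@divdiff_cons f x (x' :: t)) //= ?inE ?negb_or ?xx' ?xt ?x't //.
rewrite !divdiff_cons /= ?xt ?x't // !big_cons eqxx /=.
have neq0 (a : F) : a \notin t -> \prod_(y <- t) (a - y) != 0.
  move=> at'; rewrite prodf_seq_neq0; apply/allP => y yt; rewrite subr_eq0.
  by apply: contraNneq at' => ->.
have -> : \prod_(y <- t | y != x') (x' - y) = \prod_(y <- t) (x' - y).
  rewrite big_seq_cond [RHS]big_seq; apply: eq_bigl => y.
  by case: (boolP (y \in t)) => //= yt; apply: contraNneq x't => <-.
set A := \sum_(z <- t) _; set B := \sum_(z <- t) _; set C := \sum_(z <- t) _.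
have -> : A = (B - C) / (x - x').
  apply: (canRL (mulfK _)); first by rewrite subr_eq0.
  rewrite /A /B /C -sumrB mulr_suml big_seq [RHS]big_seq; apply: eq_bigr => z zt.
  rewrite big_cons.
  have x'z : x' != z by apply: contraNneq x't => ->.
  have xz : x != z by apply: contraNneq xt => ->.
  have p0 : \prod_(y <- t | y != z) (z - y) != 0.
    rewrite prodf_seq_neq0; apply/allP => y yt; apply/implyP; rewrite subr_eq0 eq_sym.
    by [].
  rewrite x'z; field.
  by rewrite p0 !subr_eq0 ![z == _]eq_sym xz x'z.
field.
by rewrite !neq0 // !subr_eq0 xx' eq_sym xx'.
Qed.

Lemma divdiff_const c s : uniq s -> (1 < size s)%N -> divdiff (fun=> c) s = 0.
Proof.
elim: {s}(size s) {-2}s (leqnn (size s)) => [|m IH] [|x [|x' t]] //= sz u _.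
have := divdiff_rec (fun=> c) u; move/andP: (u) => [/= xt /andP[x't ut]].
have -> : divdiff (fun=> c) (x :: t) - divdiff (fun=> c) (x' :: t) = 0.
  move: xt; rewrite inE negb_or => /andP[_ xt]; case: t {u} ut xt x't sz => [|y t] ut xt x't sz.
    by rewrite /divdiff !big_cons !big_nil !eqxx /= subrr.
  have E a : a \notin y :: t -> divdiff (fun=> c) (a :: y :: t) = 0.
    by move=> ay; apply: IH => //; rewrite cons_uniq ay ut.
  by rewrite !E ?subrr.
move/eqP; rewrite mulf_eq0 subr_eq0 => /orP[/eqP xx'|/eqP //].
by rewrite xx' inE eqxx in xt.
Qed.

(** Subtracting the constant [f x], whose divided difference vanishes, removes the
    summand of the node [x] and leaves slopes in the others. *)
Lemma divdiff_slope f x t : uniq (x :: t) -> t != [::] ->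
  divdiff f (x :: t) = divdiff (fun z => (f z - f x) / (z - x)) t.
Proof.
move=> u tN; have := divdiff_const (f x) u.
case: t tN u => // y t _ u /(_ isT); rewrite !(divdiff_cons _ u) => /eqP.
rewrite addr_eq0 => /eqP ->; rewrite addrC /divdiff -sumrB.
apply: eq_bigr => z _; rewrite invfM !mulrA; ring.
Qed.
End DividedDifferenceAlgebra.

(** * Mean value theorem for divided differences *)

Lemma near_within_ballP (R : realType) (V : normedModType R) (D : set V) (x : V)
    (P : V -> Prop) :
  (\forall z \near within D (nbhs x), P z) <->
  exists2 d : R, 0 < d & forall z, D z -> `|z - x| < d -> P z.
Proof.
split=> [/nbhs_normP[d d0 dP]|[d d0 dP]].
  by exists d => // z Dz zx; apply: dP => //=; rewrite distrC.
by apply/nbhs_normP; exists d => // z /= zx Dz; apply: dP => //; rewrite distrC.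
Qed.

Section MeanValue.
Variable R : realType.
Implicit Types (I : set R) (d : nat -> R -> R) (s t : seq R).

Definition continuous_on_at I (f : R -> R) x :=
  forall e, 0 < e -> exists2 r, 0 < r &
    forall y, I y -> `|y - x| < r -> `|f y - f x| < e.

Definition derivative_on_at I (f : R -> R) l x :=
  forall e, 0 < e -> exists2 r, 0 < r &
    forall y, I y -> y != x -> `|y - x| < r -> `|(f y - f x) / (y - x) - l| < e.

(** The derivatives are given as a sequence, so that an induction on the order of
    differentiation can shift it. *)
Definition Ck_derivatives I k d :=
  (forall j x, (j < k)%N -> I x -> derivative_on_at I (d j) (d j.+1 x) x) /\
  (forall j x, (j <= k)%N -> I x -> continuous_on_at I (d j) x).

Lemma derivative_continuous_on I f l x :
  derivative_on_at I f l x -> continuous_on_at I f x.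
Proof.
move=> /(_ 1 ltr01)[r r0 fl] e e0.
have c0 : 0 < `|l| + 1 by rewrite ltr_wpDl.
exists (Num.min r (e / (`|l| + 1))); first by rewrite lt_min r0 divr_gt0.
move=> y Iy; rewrite lt_min => /andP[yr ye].
have [->|yx] := eqVneq y x; first by rewrite subrr normr0.
have yx0 : y - x != 0 by rewrite subr_eq0.
have := fl y Iy yx yr; set q := (f y - f x) / (y - x) => ql.
have -> : f y - f x = q * (y - x) by rewrite /q mulfVK.
have qb : `|q| <= `|l| + 1.
  have -> : q = (q - l) + l by rewrite subrK.
  by rewrite (le_trans (ler_normD _ _)) // addrC lerD2l ltW.
rewrite normrM (le_lt_trans (ler_wpM2r _ qb)) // -ltr_pdivlMl //.
by rewrite mulrC.
Qed.

Lemma Ck_on_derivatives I k g : Ck_on I k g ->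
  exists2 d, Ck_derivatives I k d & forall x, I x -> d 0%N x = g x.
Proof.
case=> d [d0 dd dk]; exists d => //.
have D j x : (j < k)%N -> I x -> derivative_on_at I (d j) (d j.+1 x) x.
  move=> jk Ix e e0; have /cvgrPdist_lt/(_ e e0) := dd j jk x Ix.
  move=> /nbhs_normP[r r0 rP]; exists r => // y Iy yx yr.
  by rewrite distrC; apply: rP => //=; rewrite distrC.
split=> // j x; rewrite leq_eqVlt => /orP[/eqP ->|jk] Ix.
  move=> e e0; move/subspace_continuousP: dk => /(_ x Ix)/cvgrPdist_lt/(_ e e0).
  move=> /near_within_ballP[r r0 rP]; exists r => // y Iy yr.
  by rewrite distrC; apply: rP.
by apply: derivative_continuous_on; exact: D.
Qed.

Lemma interior_is_derive I f l x a b : is_interval I -> I a -> I b ->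
  a < x < b -> derivative_on_at I f l x -> is_derive x 1 f l.
Proof.
move=> iI Ia Ib /andP[ax xb] fl.
suff H : h^-1 *: ((f \o shift x) (h *: (1 : R)) - f x) @[h --> 0^'] --> l.
  by apply: DeriveDef; [apply/cvg_ex; exists l|exact: cvg_lim H].
apply/cvgrPdist_lt => e /fl[r r0 rP].
apply/nbhs_normP; exists (Num.min r (Num.min (x - a) (b - x))).
  by rewrite /= !lt_min r0 !subr_gt0 ax.
move=> h /=; rewrite sub0r normrN !lt_min => /and3P[hr ha hb] h0.
rewrite /= [h *: 1]mulr1 distrC [_ *: _]mulrC; have := rP (h + x); rewrite addrK; apply => //.
  move: ha hb; rewrite !ltr_norml => /andP[? _] /andP[_ ?].
  by apply: (iI a b) => //; apply/andP; split; lra.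
by rewrite -subr_eq0 addrK.
Qed.

Lemma is_derive_mulC (c : R) (f : R -> R) (df x : R) :
  is_derive x 1 f df -> is_derive x 1 (fun y => c * f y) (c * df).
Proof. by move=> fx; exact: (@is_deriveZ R R R f c x 1 df fx). Qed.

Lemma is_derive_sum_seq (J : eqType) (r : seq J) (f : J -> R -> R) (df : J -> R) (x : R) :
  (forall z, z \in r -> is_derive x 1 (f z) (df z)) ->
  is_derive x 1 (fun y => \sum_(z <- r) f z y) (\sum_(z <- r) df z).
Proof.
elim: r => [_|z r IH zr].
  rewrite big_nil (_ : (fun _ => _) = cst 0); first exact: is_derive_cst.
  by apply/funext => y; rewrite big_nil.
rewrite big_cons (_ : (fun _ => _) = f z + (fun y => \sum_(z <- r) f z y)).
  apply: is_deriveD; first by apply: zr; rewrite inE eqxx.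
  by apply: IH => y yr; apply: zr; rewrite inE yr orbT.
by apply/funext => y; rewrite big_cons.
Qed.

(** Contracting the nodes towards [x0] multiplies each of the [(size t).-1] factors
    of a denominator by [tau]. *)
Lemma divdiff_homothety f x0 (tau : R) t : tau != 0 -> uniq t ->
  tau ^+ (size t).-1 * divdiff f [seq x0 + tau * (z - x0) | z <- t] =
  \sum_(z <- t) f (x0 + tau * (z - x0)) / \prod_(y <- t | y != z) (z - y).
Proof.
move=> tau0 ut; rewrite /divdiff big_map mulr_sumr big_seq [RHS]big_seq.
apply: eq_bigr => z zt; rewrite big_map.
have -> : \prod_(y <- t | x0 + tau * (y - x0) != x0 + tau * (z - x0))
    (x0 + tau * (z - x0) - (x0 + tau * (y - x0))) =
    tau ^+ (size t).-1 * \prod_(y <- t | y != z) (z - y).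
  rewrite (eq_bigl (fun y => y != z)); last first.
    move=> y; rewrite (inj_eq (addrI _)) (inj_eq (mulfI tau0)).
    by rewrite (inj_eq (addIr _)).
  rewrite (eq_bigr (fun y => tau * (z - y))); last by move=> y _; ring.
  rewrite big_split /=; congr (_ * _).
  rewrite big_const_seq iter_mulr_1; congr (_ ^+ _).
  have := count_predC (pred1 z) t; rewrite count_uniq_mem // zt => <- //.
by rewrite invfM mulrCA !mulrA mulfK // expf_neq0.
Qed.

Lemma convex_between (x0 z tau : R) : 0 < tau < 1 -> z != x0 ->
  (x0 < x0 + tau * (z - x0) < z) \/ (z < x0 + tau * (z - x0) < x0).
Proof.
move=> /andP[t0 t1]; rewrite neq_lt => /orP[zx|xz]; [right|left].
  by apply/andP; split; nra.
by apply/andP; split; nra.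
Qed.

Lemma interval_homothety I x0 z tau : is_interval I -> I x0 -> I z ->
  0 <= tau <= 1 -> I (x0 + tau * (z - x0)).
Proof.
move=> iI Ix Iz /andP[t0 t1]; case: (lerP x0 z) => xz.
  by apply: (iI x0 z) => //; apply/andP; split; nra.
by apply: (iI z x0) => //; apply/andP; split; nra.
Qed.

Lemma homothety_within_continuous I f x0 z : is_interval I -> I x0 -> I z ->
  (forall x, I x -> continuous_on_at I f x) ->
  {within `[0, 1], continuous (fun tau => f (x0 + tau * (z - x0)))}.
Proof.
move=> iI Ix Iz fc; apply/subspace_continuousP => tau /=; rewrite in_itv /= => t01.
apply/cvgrPdist_lt => e /(fc _ (interval_homothety iI Ix Iz t01))[r r0 rP].
apply/near_within_ballP; exists (r / (`|z - x0| + 1)).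
  by rewrite divr_gt0 // ltr_wpDl.
move=> s /=; rewrite in_itv /= => s01 sr; rewrite distrC; apply: rP.
  exact: interval_homothety.
rewrite opprD addrACA subrr add0r -mulrBl normrM.
move: sr; rewrite ltr_pdivlMr ?ltr_wpDl //; apply: le_lt_trans.
by rewrite ler_wpM2l // lerDl.
Qed.

(** Contract all nodes towards the first one, [x0]. Moving only the numerators of the
    slopes at [x0] along this contraction gives a function of [tau] that runs from 0
    to the divided difference [C]; its derivative is [tau ^+ j] times a divided
    difference of the derivative at the contracted nodes. Comparison with
    [C * tau ^+ j.+1] by Rolle's theorem lowers the order by one. *)
Lemma divdiff_mean_value I j d t (c r : R) : is_interval I -> Ck_derivatives I j d ->
  uniq t -> size t = j.+1 -> (forall y, y \in t -> I y /\ `|y - c| < r) ->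
  exists2 xi, I xi /\ `|xi - c| < r & divdiff (d 0%N) t = d j xi / j`!%:R.
Proof.
move=> iI; elim: j d t => [|j IH] d t [dd dc].
  case: t => [|x [|//]] //= _ _ /(_ x); rewrite inE eqxx => /(_ isT) Ix.
  exists x => //; rewrite /divdiff !big_cons !big_nil eqxx /=.
  by rewrite fact0 addr0.
case: t => [//|x0 t] ut [szt] It.
have [Ix0 xr] := It x0 (mem_head _ _).
have {}It z : z \in t -> [/\ I z, `|z - c| < r & z != x0].
  move=> zt; have [] := It z; first by rewrite inE zt orbT.
  move=> Iz zr; split=> //; have /= /andP[x0t _] := ut.
  by apply: contraNneq x0t => <-.
set C := divdiff (d 0%N) (x0 :: t).
pose w z := \prod_(y <- t | y != z) (z - y).
pose h (tau z : R) : R := x0 + tau * (z - x0).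
pose psi := (fun tau : R => \sum_(z <- t) d 0%N (h tau z) / ((z - x0) * w z)) +
            (fun tau : R => - C * tau ^+ j.+1).
have psi01 : psi 0 = psi 1.
  pose S (tau : R) := \sum_(z <- t) d 0%N (h tau z) / ((z - x0) * w z).
  have psiE tau : psi tau = S tau + - C * tau ^+ j.+1 by [].
  have SC : S 1 - S 0 = C.
    rewrite /S -sumrB /C divdiff_slope //; last by case: (t) szt.
    apply: eq_bigr => z _; rewrite /h mul0r addr0 mul1r [x0 + _]addrC subrK -mulrBl.
    by rewrite invfM mulrA.
  by rewrite !psiE expr0n expr1n -SC /=; ring.
have dpsi (tau : R) : 0 < tau < 1 -> is_derive tau 1 psi
    (\sum_(z <- t) d 1%N (h tau z) / w z + - C * (j.+1%:R * tau ^+ j)).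
  move=> t01; apply: is_deriveD; last first.
    apply: is_derive_mulC; rewrite (_ : (fun _ => _) = (@id R) ^+ j.+1); last first.
      by apply/funext => s; rewrite /= exprfctE.
    have := @is_deriveX R R id j.+1 tau 1 1 (is_derive_id _ _).
    by rewrite [_ *: _]mulr1.
  apply: is_derive_sum_seq => z /It[Iz zr zx].
  have zx0 : z - x0 != 0 by rewrite subr_eq0.
  have hd : is_derive (h tau z) 1 (d 0%N) (d 1%N (h tau z)).
    have Ih : I (h tau z).
      by apply: interval_homothety => //; case/andP: t01 => *; rewrite !ltW.
    have [H|H] := convex_between t01 zx.
      by apply: (interior_is_derive iI Ix0 Iz) => //; apply: dd.
    by apply: (interior_is_derive iI Iz Ix0) => //; apply: dd.
  have hz : is_derive tau 1 (h ^~ z) (z - x0).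
    rewrite (_ : h ^~ z = cst x0 + (fun y => (z - x0) * y)).
      rewrite -[X in is_derive _ _ _ X]add0r; apply: is_deriveD.
      by rewrite -[X in is_derive _ _ _ X]mulr1; apply: is_derive_mulC.
    by apply/funext => s; rewrite /h !fctE mulrC.
  have dz : is_derive tau 1 (d 0%N \o h ^~ z) (d 1%N (h tau z) * (z - x0)).
    exact: is_derive1_comp.
  rewrite (_ : (fun y => _) = (fun y => ((z - x0) * w z)^-1 * d 0%N (h y z))); last first.
    by apply/funext => s /=; rewrite mulrC.
  apply: (is_derive_eq (is_derive_mulC ((z - x0) * w z)^-1 dz)).
  by rewrite mulrC invfM mulrA mulfK.
have cpsi : {within `[0, 1], continuous psi}.
  move=> tau; apply: cvgD; last first.
    by apply: cvgM; [exact: cvg_cst|exact: (continuous_subspaceT (@exprn_continuous R j.+1))].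
  rewrite big_seq (_ : (fun _ => _) = fun s : R => \sum_(z <- t | z \in t)
      d 0%N (h s z) / ((z - x0) * w z)); last by apply/funext => s; rewrite big_seq.
  apply: cvg_big => [|z /It[Iz _ _]].
    exact: add_continuous.
  apply: cvgM; last exact: cvg_cst.
  by apply: (homothety_within_continuous iI Ix0 Iz) => x Ix; apply: dc.
have [tau t01 tauP] : exists2 tau : R, 0 < tau < 1 & is_derive tau 1 psi 0.
  have psi_der (x : R) : x \in `]0, 1[ -> derivable psi x 1.
    by rewrite in_itv /= => /dpsi[].
  have [tau] := Rolle ltr01 psi_der cpsi psi01.
  by rewrite in_itv /=; exists tau.
have tau0 : tau != 0 by case/andP: t01 => /lt0r_neq0.
have [||||xi xiP xiE] := IH (fun i => d i.+1) (map (h tau) t).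
- by split=> [i x ij|i x ij]; [apply: dd|apply: dc].
- rewrite map_inj_uniq; first by have /andP[] := ut.
  by move=> y z /addrI /(mulfI tau0) /addIr.
- by rewrite size_map.
- move=> y /mapP[z zt ->]; have [Iz zr zx] := It z zt; split.
    by apply: interval_homothety => //; case/andP: t01 => *; rewrite !ltW.
  rewrite /h; have -> : x0 + tau * (z - x0) - c = (1 - tau) * (x0 - c) + tau * (z - c) by ring.
  move: t01 xr zr => /andP[t0 t1]; rewrite !ltr_norml => /andP[? ?] /andP[? ?].
  by apply/andP; split; nra.
exists xi => //.
have [_ D1] := tauP; have [_ D2] := dpsi _ t01; move: D1; rewrite D2.
have ut' : uniq t by have /andP[] := ut.
rewrite /w -divdiff_homothety // xiE szt /= mulNr.
move=> /eqP; rewrite subr_eq0 => /eqP E.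
have tj : tau ^+ j != 0 by rewrite expf_neq0.
have {}E : d j.+1 xi / j`!%:R = C * j.+1%:R.
  by apply: (mulfI tj); rewrite E; ring.
rewrite factS natrM invfM mulrCA E mulrC mulfK //.
Qed.
End MeanValue.

(** * Continuous extension of the divided differences *)

Section ContinuousExtension.
Variables (R : realType) (I : set R) (k : nat) (d : nat -> R -> R).
Hypotheses (iI : is_interval I) (I_nondeg : exists a b, [/\ I a, I b & a < b]).
Hypothesis dI : Ck_derivatives I k d.
Implicit Types (s t : seq R).

Definition nodes_in s := forall x, x \in s -> I x.

Definition near_nodes (r : R) s t := all2 (fun x y => `|x - y| < r) s t.

Definition divdiff_limit s (l : R) := forall e, 0 < e -> exists2 r, 0 < r &
  forall t, uniq t -> nodes_in t -> near_nodes r t s ->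
    `|divdiff (d 0%N) t - l| < e.

Lemma nodes_in_cat s t : nodes_in (s ++ t) <-> nodes_in s /\ nodes_in t.
Proof.
split=> [H|[Hs Ht] x]; last by rewrite mem_cat => /orP[/Hs|/Ht].
by split=> x xs; apply: H; rewrite mem_cat xs ?orbT.
Qed.

Lemma nodes_in_cons x s : nodes_in (x :: s) <-> I x /\ nodes_in s.
Proof.
split=> [H|[Hx Hs] y]; last by rewrite inE => /orP[/eqP->|/Hs].
by split=> [|y ys]; apply: H; rewrite inE ?eqxx ?ys ?orbT.
Qed.

Lemma near_nodes_le r r' s t : r <= r' -> near_nodes r s t -> near_nodes r' s t.
Proof.
move=> rr'; elim: s t => [|x s IH] [|y t] //= /andP[xy /IH ->].
by rewrite (lt_le_trans xy).
Qed.

Lemma near_nodes_size r s t : near_nodes r s t -> size s = size t.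
Proof. by elim: s t => [|x s IH] [|y t] //= /andP[_ /IH ->]. Qed.

Lemma near_nodes_trans r r' s t u :
  near_nodes r s t -> near_nodes r' t u -> near_nodes (r + r') s u.
Proof.
elim: s t u => [|x s IH] [|y t] [|z u] //= /andP[xy st] /andP[yz tu].
by rewrite (IH _ _ st tu) andbT (le_lt_trans (ler_distD y _ _)) ?ltrD.
Qed.

Lemma near_nodes_catr r t s1 s2 : near_nodes r t (s1 ++ s2) ->
  exists t1 t2, [/\ t = t1 ++ t2, near_nodes r t1 s1 & near_nodes r t2 s2].
Proof.
elim: s1 t => [|x s1 IH] t /=; first by exists [::], t.
case: t => [//|y t] /= /andP[yx /IH[t1 [t2 [-> H1 H2]]]].
by exists (y :: t1), t2; split=> //=; rewrite yx.
Qed.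

Lemma near_nodes_cat r s1 s2 t1 t2 : near_nodes r s1 t1 -> near_nodes r s2 t2 ->
  near_nodes r (s1 ++ s2) (t1 ++ t2).
Proof. by elim: s1 t1 => [|x s1 IH] [|y t1] //= /andP[-> /IH H] /H. Qed.

Lemma near_nodes_nth r s t i : near_nodes r s t -> (i < size t)%N ->
  `|s`_i - t`_i| < r.
Proof.
by elim: s t i => [|x s IH] [|y t] [|i] //= /andP[xy st] // it; apply: IH.
Qed.

(** Among [(size t).+1] points of [I] close to [x], one is missing from [t]. *)
Lemma exists_node_notin x t r : I x -> 0 < r ->
  exists y, [/\ I y, `|y - x| < r & y \notin t].
Proof.
move=> Ix r0.
have [c Ic cx] : exists2 c, I c & c != x.
  have [a [b [Ia Ib ab]]] := I_nondeg; have [xa|xa] := eqVneq a x; last by exists a.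
  by exists b => //; rewrite -xa gt_eqF.
have cx0 : 0 < `|c - x| by rewrite normr_gt0 subr_eq0.
have m0 : 0 < Num.min 1 (r / `|c - x|) by rewrite lt_min ltr01 divr_gt0.
(* The points [y i] lie on the segment from [x] to [c] and, as [i <= size t], closer
   to [x] than [r]. *)
pose q := Num.min 1 (r / `|c - x|) / (size t).+2%:R.
have q0 : 0 < q by rewrite divr_gt0.
pose y (i : nat) := x + (i%:R * q) * (c - x).
have uy : uniq (map y (iota 0 (size t).+1)).
  rewrite map_inj_uniq ?iota_uniq // => i j /addrI /mulIf.
  rewrite subr_eq0 => /(_ cx) /(mulIf (lt0r_neq0 q0)) /eqP.
  by rewrite eqr_nat => /eqP.
have [/allP sub|/allPn[z /mapP[i]]] := boolP (all (mem t) (map y (iota 0 (size t).+1))).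
  by have := uniq_leq_size uy sub; rewrite size_map size_iota ltnn.
rewrite mem_iota /= add0n => it -> /= yt; exists (y i); split=> //.
  apply: interval_homothety => //; rewrite mulr_ge0 ?(ltW q0) //=.
  rewrite /q mulrA ler_pdivrMr // mul1r.
  have : Num.min 1 (r / `|c - x|) <= 1 by rewrite ge_min lexx.
  move=> /(ler_wpM2l (ler0n _ i)) /le_trans; apply.
  by rewrite mulr1 ler_nat ltnW // ltnW.
rewrite /y addrC addKr normrM -ltr_pdivlMr //.
have -> : `|i%:R * q| = i%:R * q by rewrite ger0_norm // mulr_ge0 // ltW.
rewrite /q mulrA ltr_pdivrMr //.
have mr : Num.min 1 (r / `|c - x|) <= r / `|c - x| by rewrite ge_min lexx orbT.
have rc : 0 < r / `|c - x| by rewrite divr_gt0.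
apply: (le_lt_trans (ler_wpM2l (ler0n _ i) mr)).
by rewrite mulrC ltr_pM2l // ltr_nat ltnW.
Qed.

Lemma uniq_nodes_dense s r : nodes_in s -> 0 < r ->
  exists t, [/\ uniq t, nodes_in t & near_nodes r t s].
Proof.
move=> + r0; elim: s => [_|x s IH]; first by exists [::].
move=> /nodes_in_cons[Ix /IH[t [ut It ts]]].
have [y [Iy yx yt]] := exists_node_notin t Ix r0.
exists (y :: t); split; rewrite /= ?yt ?ut ?yx //.
by apply/nodes_in_cons.
Qed.

Lemma divdiff_limit_unique s l l' : nodes_in s ->
  divdiff_limit s l -> divdiff_limit s l' -> l = l'.
Proof.
move=> Is sl sl'; apply/eqP; rewrite -subr_eq0 -normr_eq0; apply/negP => /negP ll'.
have e0 : 0 < `|l - l'| / 2 by rewrite divr_gt0 // lt_def ll' normr_ge0.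
have [r r0 rP] := sl _ e0; have [r' r'0 rP'] := sl' _ e0.
have m0 : 0 < Num.min r r' by rewrite lt_min r0.
have [t [ut It ts]] := uniq_nodes_dense Is m0.
have := rP t ut It (near_nodes_le _ ts); rewrite ge_min lexx => /(_ isT).
have := rP' t ut It (near_nodes_le _ ts); rewrite ge_min lexx orbT => /(_ isT).
move=> H1; rewrite distrC => H2; have := ltrD H2 H1; rewrite -splitr.
by move=> /(le_lt_trans (ler_distD _ _ _)); rewrite ltxx.
Qed.

Lemma quotient_continuous (a b e : R) : b != 0 -> 0 < e -> exists2 r, 0 < r &
  forall a' b', `|a' - a| < r -> `|b' - b| < r -> `|a' / b' - a / b| < e.
Proof.
move=> b0 e0.
have : (fun p : R * R => p.1 / p.2) @ nbhs (a, b) --> a / b.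
  by apply: cvgM; [exact: cvg_fst|apply: cvgV => //; exact: cvg_snd].
move=> /cvgrPdist_lt/(_ e e0)/nbhs_ballP[r /= r0 rP]; exists r => // a' b' aa bb.
by rewrite distrC; apply: (rP (a', b')); split; rewrite /ball /= distrC.
Qed.

(** Near a list with two distinct neighbours the recursion presents the divided
    difference as a quotient with denominator bounded away from 0. *)
Lemma divdiff_limit_rec s1 x x' s2 l l' : x != x' ->
  divdiff_limit (s1 ++ x :: s2) l -> divdiff_limit (s1 ++ x' :: s2) l' ->
  divdiff_limit (s1 ++ x :: x' :: s2) ((l - l') / (x - x')).
Proof.
rewrite -subr_eq0 => xx' L L' e e0; have [q q0 qP] := quotient_continuous (l - l') xx' e0.
have q20 : 0 < q / 2 by rewrite divr_gt0.
have [r r0 rP] := L _ q20; have [r' r'0 rP'] := L' _ q20.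
exists (Num.min (q / 2) (Num.min r r')); first by rewrite !lt_min q20 r0.
move=> t ut It /near_nodes_catr[t1 [[|y [|y' t2]] [tE ts1]]] //=.
  by rewrite andbF.
move=> ts; move: ut It ts; rewrite {}tE => ut /nodes_in_cat[It1].
move=> /nodes_in_cons[Iy /nodes_in_cons[Iy' It2]] /and3P[yx yx' ts2].
have pt z : perm_eq (z :: t1 ++ t2) (t1 ++ z :: t2).
  exact/permPl/(perm_catCA [:: z] t1 t2).
have pt2 : perm_eq (t1 ++ y :: y' :: t2) (y :: y' :: t1 ++ t2).
  by rewrite perm_sym; exact/permPl/(perm_catCA [:: y; y'] t1 t2).
have u2 : uniq (y :: y' :: t1 ++ t2) by rewrite -(perm_uniq pt2).
have := u2; rewrite 2!cons_uniq inE negb_or => /andP[/andP[yy' yt] /andP[y't u12]].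
have near12 (rho : R) z z' : Num.min (q / 2) (Num.min r r') <= rho -> `|z - z'| < rho ->
    near_nodes rho (t1 ++ z :: t2) (s1 ++ z' :: s2).
  move=> le zz'; apply: near_nodes_cat; first exact: near_nodes_le ts1.
  by rewrite /= zz'; apply: near_nodes_le ts2.
rewrite (perm_divdiff _ pt2).
have -> : divdiff (d 0%N) (y :: y' :: t1 ++ t2) =
    (divdiff (d 0%N) (t1 ++ y :: t2) - divdiff (d 0%N) (t1 ++ y' :: t2)) / (y - y').
  rewrite -!(perm_divdiff _ (pt _)) -divdiff_rec // mulrAC mulfV ?mul1r //.
  by rewrite subr_eq0.
have lr : Num.min (q / 2) (Num.min r r') <= r by rewrite !ge_min lexx orbT.
have lr' : Num.min (q / 2) (Num.min r r') <= r' by rewrite !ge_min lexx !orbT.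
have lq : Num.min (q / 2) (Num.min r r') <= q / 2 by rewrite ge_min lexx.
apply: qP.
  rewrite opprD opprK addrACA [q]splitr.
  rewrite (le_lt_trans (ler_normD _ _)) // ltrD //.
    apply: rP; rewrite -?(perm_uniq (pt _)) /= ?yt //.
      by apply/nodes_in_cat; split=> //; apply/nodes_in_cons.
    by apply: near12 => //; apply: lt_le_trans yx lr.
  rewrite addrC distrC.
  apply: rP'; rewrite -?(perm_uniq (pt _)) /= ?y't //.
    by apply/nodes_in_cat; split=> //; apply/nodes_in_cons.
  by apply: near12 => //; apply: lt_le_trans yx' lr'.
have -> : y - y' - (x - x') = (y - x) - (y' - x') by ring.
rewrite [q]splitr (le_lt_trans (ler_normB _ _)) // ltrD //.
  exact: lt_le_trans yx lq.
exact: lt_le_trans yx' lq.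
Qed.

Lemma constant_or_split s : s != [::] -> s = nseq (size s) (head 0 s) \/
  exists s1 x x' s2, s = s1 ++ x :: x' :: s2 /\ x != x'.
Proof.
elim: s => [//|x [|x' s] IH] _; first by left.
have [xx'|xx'] := eqVneq x x'; last by right; exists [::], x, x', s.
case: (IH isT) => [/= E|[s1 [y [y' [s2 [-> yy']]]]]].
  by left; rewrite /= xx' {1}E.
by right; exists (x :: s1), y, y', s2.
Qed.

(** Near a constant list the recursion degenerates, but there the mean value theorem
    expresses the divided difference through a value of the j-th derivative near [c]. *)
Lemma divdiff_limit_nseq j c : (j <= k)%N -> I c ->
  divdiff_limit (nseq j.+1 c) (d j c / j`!%:R).
Proof.
move=> jk Ic e e0; case: dI => dd dc.
have [r r0 rP] := dc j c jk Ic e e0; exists r => // t ut It ts.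
have szt : size t = j.+1 by rewrite (near_nodes_size ts) size_nseq.
have tc y : y \in t -> I y /\ `|y - c| < r.
  move=> yt; split; first exact: It.
  have := near_nodes_nth (i := index y t) ts; rewrite size_nseq -szt index_mem yt nth_index //.
  by rewrite nth_nseq index_mem yt; apply.
have dj : Ck_derivatives I j d.
  by split=> i x ij; [apply: dd|apply: dc]; apply: leq_trans jk.
have [xi [Ixi xic] ->] := divdiff_mean_value iI dj ut szt tc.
rewrite -mulrBl normrM; apply: le_lt_trans (rP xi Ixi xic).
rewrite ler_piMr // ger0_norm ?invr_ge0 ?ler0n // invf_le1 ?ltr0n ?fact_gt0 //.
by rewrite ler1n fact_gt0.
Qed.

(** Every list is constant or has two distinct neighbours, so divdiff_limit_nseq or
    divdiff_limit_rec applies. *)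
Lemma divdiff_limit_exists j s : (j <= k)%N -> size s = j.+1 -> nodes_in s ->
  exists2 l, divdiff_limit s l & uniq s -> l = divdiff (d 0%N) s.
Proof.
elim: j s => [|j IH] s jk szs Is.
  case: s szs Is => [|x [|//]] // _ /nodes_in_cons[Ix _].
  exists (d 0%N x / 0`!%:R); first exact: (divdiff_limit_nseq jk Ix).
  by rewrite /divdiff !big_cons !big_nil eqxx addr0.
have sN : s != [::] by case: (s) szs.
have [|[s1 [x [x' [s2 [sE xx']]]]]] := constant_or_split sN.
  rewrite szs => ->; exists (d j.+1 (head 0 s) / (j.+1)`!%:R).
    by apply: divdiff_limit_nseq => //; case: (s) szs Is => //= x t _ /nodes_in_cons[].
  by rewrite /= inE eqxx.
move: szs Is; rewrite {}sE size_cat /= => szs Is.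
have [Is1 Ix Ix' Is2] : [/\ nodes_in s1, I x, I x' & nodes_in s2].
  by move: Is => /nodes_in_cat[? /nodes_in_cons[? /nodes_in_cons[]]].
have I1 y : I y -> nodes_in (s1 ++ y :: s2).
  by move=> Iy; apply/nodes_in_cat; split=> //; apply/nodes_in_cons.
have sz1 y : size (s1 ++ y :: s2) = j.+1.
  by rewrite size_cat /=; move: szs; rewrite !addnS => -[->].
have [l L lE] := IH _ (ltnW jk) (sz1 x) (I1 x Ix).
have [l' L' l'E] := IH _ (ltnW jk) (sz1 x') (I1 x' Ix').
exists ((l - l') / (x - x')); first exact: divdiff_limit_rec.
have pt z : perm_eq (z :: s1 ++ s2) (s1 ++ z :: s2).
  exact/permPl/(perm_catCA [:: z] s1 s2).
have pt2 : perm_eq (s1 ++ x :: x' :: s2) (x :: x' :: s1 ++ s2).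
  by rewrite perm_sym; exact/permPl/(perm_catCA [:: x; x'] s1 s2).
rewrite (perm_uniq pt2) (perm_divdiff _ pt2) => u2.
have := u2; rewrite 2!cons_uniq inE negb_or => /andP[/andP[_ xs] /andP[x's u12]].
rewrite lE ?l'E -?(perm_uniq (pt _)) ?cons_uniq ?xs ?x's //.
rewrite -!(perm_divdiff _ (pt _)) -divdiff_rec // mulrAC mulfV ?mul1r //.
by rewrite subr_eq0.
Qed.

Lemma divdiff_limit_perm s s' l : perm_eq s s' -> divdiff_limit s l ->
  divdiff_limit s' l.
Proof.
move=> /(perm_iotaP 0)[Is pI ->] L e /L[r r0 rP]; exists r => // t ut It ts.
have szt := near_nodes_size ts.
have pt : perm_eq (map (nth 0 t) Is) t by apply/(perm_iotaP 0); exists Is; rewrite ?szt.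
rewrite -(perm_divdiff _ pt); apply: rP.
- by rewrite (perm_uniq pt).
- by move=> x; rewrite (perm_mem pt) => /It.
have : {subset Is <= iota 0 (size t)} by move=> i; rewrite (perm_mem pI) szt.
elim: (Is) => //= i Js IH sub; rewrite IH => [|j jJ]; last by apply: sub; rewrite inE jJ orbT.
rewrite andbT near_nodes_nth // -szt.
by have := sub i (mem_head _ _); rewrite mem_iota.
Qed.

Definition divdiff_ext s : R := xget 0 [set l | divdiff_limit s l].

Lemma divdiff_extP j s : (j <= k)%N -> size s = j.+1 -> nodes_in s ->
  divdiff_limit s (divdiff_ext s).
Proof.
move=> jk szs /(divdiff_limit_exists jk szs)[l L _].
by rewrite /divdiff_ext; case: xgetP => [l' -> //|/(_ l)].
Qed.

Lemma divdiff_ext_uniq j s : (j <= k)%N -> size s = j.+1 -> nodes_in s ->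
  uniq s -> divdiff_ext s = divdiff (d 0%N) s.
Proof.
move=> jk szs Is us; have [l L <- //] := divdiff_limit_exists jk szs Is.
exact: divdiff_limit_unique Is (divdiff_extP jk szs Is) L.
Qed.

Lemma divdiff_ext_perm s s' : perm_eq s s' -> divdiff_ext s = divdiff_ext s'.
Proof.
move=> ss'; congr xget; apply/seteqP.
by split=> l /=; apply: divdiff_limit_perm; rewrite // perm_sym.
Qed.

Lemma divdiff_ext_rec j s1 x x' s2 : (j.+1 <= k)%N -> (size s1 + size s2)%N = j ->
  nodes_in s1 -> I x -> I x' -> nodes_in s2 ->
  divdiff_ext (s1 ++ x :: s2) - divdiff_ext (s1 ++ x' :: s2) =
  (x - x') * divdiff_ext (s1 ++ x :: x' :: s2).
Proof.
move=> jk szs Is1 Ix Ix' Is2; have [->|xx'] := eqVneq x x'; first by rewrite !subrr mul0r.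
have I1 y : I y -> nodes_in (s1 ++ y :: s2).
  by move=> Iy; apply/nodes_in_cat; split=> //; apply/nodes_in_cons.
have sz1 y : size (s1 ++ y :: s2) = j.+1 by rewrite size_cat /= addnS szs.
have L := divdiff_extP (ltnW jk) (sz1 x) (I1 x Ix).
have L' := divdiff_extP (ltnW jk) (sz1 x') (I1 x' Ix').
have I2 : nodes_in (s1 ++ x :: x' :: s2).
  by apply/nodes_in_cat; split=> //; do 2!(apply/nodes_in_cons; split => //).
have sz2 : size (s1 ++ x :: x' :: s2) = j.+2 by rewrite size_cat /= !addnS szs.
rewrite (divdiff_limit_unique I2 (divdiff_extP jk sz2 I2) (divdiff_limit_rec xx' L L')).
by rewrite mulrC mulfVK // subr_eq0.
Qed.

Lemma divdiff_ext_continuous j s e : (j <= k)%N -> size s = j.+1 -> nodes_in s -> 0 < e ->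
  exists2 r, 0 < r & forall t, nodes_in t -> near_nodes r t s ->
    `|divdiff_ext t - divdiff_ext s| < e.
Proof.
move=> jk szs Is e0; have e20 : 0 < e / 2 by rewrite divr_gt0.
have [r r0 rP] := divdiff_extP jk szs Is e20.
have r20 : 0 < r / 2 by rewrite divr_gt0.
exists (r / 2) => // t It ts; have szt := near_nodes_size ts; rewrite szs in szt.
have [r' r'0 rP'] := divdiff_extP jk szt It e20.
have m0 : 0 < Num.min (r / 2) r' by rewrite lt_min r20.
have [u [uu Iu ut]] := uniq_nodes_dense It m0.
rewrite (le_lt_trans (ler_distD (divdiff (d 0%N) u) _ _)) // [e]splitr ltrD //.
  by rewrite distrC; apply: rP' => //; apply: near_nodes_le ut; rewrite ge_min lexx orbT.
apply: rP => //; rewrite [r]splitr; apply: near_nodes_trans ts.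
by apply: near_nodes_le ut; rewrite ge_min lexx.
Qed.

Lemma divdiff_ext1 x : I x -> divdiff_ext [:: x] = d 0%N x.
Proof.
move=> Ix; rewrite (@divdiff_ext_uniq 0) // /divdiff ?big_cons ?big_nil ?eqxx ?addr0.
  by rewrite divr1.
by apply/nodes_in_cons.
Qed.
End ContinuousExtension.

(** * Vandermonde quotients are divided differences *)

Section MatrixNorm.
Variables (R : realType) (m n : nat).
Implicit Type M : 'M[R]_(m, n).

Lemma mx_entry_le_norm M i j : `|M i j| <= `|M|.
Proof.
rewrite [leRHS]mx_normrE.
exact: (@le_bigmax _ _ _ 0 (fun ij : 'I_m * 'I_n => `|M ij.1 ij.2|) (i, j)).
Qed.

Lemma mx_norm_le M c : 0 <= c -> (forall i j, `|M i j| <= c) -> `|M| <= c.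
Proof. by move=> c0 H; rewrite [leLHS]mx_normrE; apply: bigmax_le. Qed.

Lemma mx_norm_lt M c : 0 < c -> (forall i j, `|M i j| < c) -> `|M| < c.
Proof. by move=> c0 H; rewrite [ltLHS]mx_normrE; apply: bigmax_lt. Qed.
End MatrixNorm.

Section VandermondeQuotient.
Variable R : realType.

Definition row_nodes s (x : 'rV[R]_s) : seq R := [seq x 0 i | i <- enum 'I_s].

Lemma size_row_nodes s (x : 'rV[R]_s) : size (row_nodes x) = s.
Proof. by rewrite size_map size_enum_ord. Qed.

Lemma row_nodes_uniq s (x : 'rV[R]_s) : injective (x 0) -> uniq (row_nodes x).
Proof. by move=> xinj; rewrite map_inj_uniq ?enum_uniq. Qed.

Definition descending_vandermonde s (x : 'rV[R]_s) : 'M[R]_s := \matrix_(i, j) x 0 j ^+ (s - i.+1).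

Lemma vandermonde_neq0 s (x : 'rV[R]_s) : injective (x 0) -> vandermonde x != 0.
Proof.
move=> xinj; rewrite /vandermonde -/(descending_vandermonde x).
have -> : descending_vandermonde x = row_perm (perm rev_ord_inj) (Vandermonde s x).
  by apply/matrixP => i j; rewrite !mxE permE.
rewrite row_permE det_mulmx det_perm mulf_neq0 ?signr_eq0 // det_Vandermonde.
apply/prodf_neq0 => i _; apply/prodf_neq0 => j ij.
by rewrite subr_eq0; apply: contraTneq ij => /xinj ->; rewrite ltnn.
Qed.

(** The cofactors of the first row are orthogonal to all other rows, which hold the
    powers below [s]; only the coefficient of degree [s] survives. *)
Lemma vandermonde_cofactor_poly s (x : 'rV[R]_s.+1) (p : {poly R}) :
  (size p <= s.+1)%N ->
  \sum_j p.[x 0 j] * cofactor (descending_vandermonde x) 0 j = p`_s * vandermonde x.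
Proof.
move=> szp.
transitivity (\sum_(i < s.+1) p`_(s - i) *
    (descending_vandermonde x *m \adj (descending_vandermonde x)) i 0).
  under [RHS]eq_bigr do rewrite mxE mulr_sumr.
  rewrite exchange_big; apply: eq_bigr => j _.
  rewrite (horner_coef_wide _ szp) mulr_suml (reindex_inj rev_ord_inj) /=.
  apply: eq_bigr => i _.
  by rewrite [descending_vandermonde x _ _]mxE [\adj _ _ _]mxE subSS /cofactor !mulrA.
rewrite mul_mx_adj (bigD1 ord0) //= big1 => [|i i0].
  by rewrite !mxE eqxx subn0 addr0.
by rewrite !mxE (negbTE i0) mulr0.
Qed.

(** Testing the cofactors of the first row against the polynomial that vanishes
    at all nodes but one isolates the cofactor of that node. *)
Lemma vandermonde_quotient_divdiff s (x : 'rV[R]_s.+1) g : injective (x 0) ->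
  vandermonde_first_row (map_mx g x) x / vandermonde x = divdiff g (row_nodes x).
Proof.
move=> xinj; have v0 := vandermonde_neq0 xinj.
pose w j := \prod_(l | l != j) (x 0 j - x 0 l).
have w0 j : w j != 0.
  apply/prodf_neq0 => l lj; rewrite subr_eq0; apply: contraNneq lj => /xinj ->.
  exact: eqxx.
have cofE j : cofactor (descending_vandermonde x) 0 j = vandermonde x / w j.
  pose p := \prod_(l | l != j) ('X - (x 0 l)%:P).
  have pE : p = \prod_(l <- enum (predC1 j)) ('X - (x 0 l)%:P).
    by rewrite big_enum; apply: eq_bigl.
  have szp : size p = s.+1.
    by rewrite pE size_prod_XsubC -cardE cardC1 card_ord.
  have := @vandermonde_cofactor_poly s x p; rewrite szp => /(_ (leqnn _)).
  have -> : p`_s = 1.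
    have : p \is monic by rewrite pE monic_prod_XsubC.
    by rewrite monicE /lead_coef szp => /eqP.
  rewrite mul1r (bigD1 j) //= big1 => [|i ij].
    rewrite addr0 /p horner_prod => <-; rewrite -/(w j).
    under eq_bigr do rewrite hornerXsubC.
    by rewrite mulrAC mulfV ?w0 // mul1r.
  rewrite /p horner_prod (bigD1 i) //= hornerXsubC subrr mul0r.
  by rewrite mul0r.
rewrite /vandermonde_first_row (expand_det_row _ ord0) mulr_suml.
rewrite /divdiff /row_nodes big_map big_enum; apply: eq_bigr => j _.
rewrite mxE /= mxE big_map big_enum_cond.
rewrite (eq_bigl (fun l => l != j)) => [|l]; last by rewrite (inj_eq xinj).
set c := cofactor _ _ _.
have -> : c = cofactor (descending_vandermonde x) 0 j.
  rewrite /c /cofactor; congr (_ * \det _).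
  by apply/matrixP => a b; rewrite !mxE.
by rewrite cofE mulrA mulrAC mulfK // mulrC.
Qed.

Lemma near_row_nodes s (x y : 'rV[R]_s) r : `|x - y| < r ->
  near_nodes r (row_nodes x) (row_nodes y).
Proof.
move=> xy; rewrite /row_nodes; elim: (enum 'I_s) => //= i t ->; rewrite andbT.
have := mx_entry_le_norm (x - y) 0 i; rewrite !mxE => /le_lt_trans; exact.
Qed.

Variables (I : set R) (k : nat) (d : nat -> R -> R) (g : R -> R).
Hypotheses (iI : is_interval I) (I_nondeg : exists a b, [/\ I a, I b & a < b]).
Hypotheses (dI : Ck_derivatives I k d) (d0 : forall x, I x -> d 0%N x = g x).

Lemma eq_divdiff (f h : R -> R) t : nodes_in I t -> (forall x, I x -> f x = h x) ->
  divdiff f t = divdiff h t.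
Proof.
move=> It fh; rewrite /divdiff big_seq [RHS]big_seq.
by apply: eq_bigr => x /It/fh ->.
Qed.

Lemma row_nodes_in s (x : 'rV[R]_s) : cube I x -> nodes_in I (row_nodes x).
Proof. by move=> Ix _ /mapP[i _ ->]. Qed.

Lemma divdiff_ext_is_continuous_extension :
  is_continuous_extension I g (fun x : 'rV_k.+1 => divdiff_ext I d (row_nodes x)).
Proof.
split=> [|x Ix xinj].
  apply/subspace_continuousP => x Ix; apply/cvgrPdist_lt => e e0.
  have [r r0 rP] := divdiff_ext_continuous iI I_nondeg dI (leqnn k)
    (size_row_nodes x) (row_nodes_in Ix) e0.
  apply/near_within_ballP; exists r => // y Iy yx; rewrite distrC.
  by apply: rP; [exact: row_nodes_in|exact: near_row_nodes].
rewrite (divdiff_ext_uniq iI I_nondeg dI (leqnn k) (size_row_nodes x)).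
- by rewrite vandermonde_quotient_divdiff //; apply: eq_divdiff => //; exact: row_nodes_in.
- exact: row_nodes_in.
- exact: row_nodes_uniq.
Qed.

(** Lists without repetition are dense, so a continuous extension has no choice but
    to be the limit of the quotients. *)
Lemma continuous_extension_limit E (x : 'rV[R]_k.+1) :
  is_continuous_extension I g E -> cube I x -> divdiff_limit I d (row_nodes x) (E x).
Proof.
case=> Ec Eq Ix e e0; move/subspace_continuousP: Ec => /(_ x Ix)/cvgrPdist_lt/(_ e e0).
move=> /near_within_ballP[r r0 rP]; exists r => // t ut It tx.
have szt : size t = k.+1 by rewrite (near_nodes_size tx) size_row_nodes.
pose y := \row_(i < k.+1) t`_i.
have yt : row_nodes y = t.
  apply: (@eq_from_nth _ 0); first by rewrite size_row_nodes.
  move=> i; rewrite size_row_nodes => ik.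
  rewrite (nth_map ord0) ?size_enum_ord // mxE; congr nth.
  exact: (nth_enum_ord ord0 ik).
have Iy : cube I y by move=> i; rewrite mxE; apply: It; rewrite mem_nth ?szt.
have yinj : injective (y 0).
  move=> i j; rewrite !mxE => /eqP; rewrite nth_uniq ?szt // => /eqP; exact: val_inj.
have -> : divdiff (d 0%N) t = E y.
  by rewrite Eq // vandermonde_quotient_divdiff // yt; apply: eq_divdiff.
rewrite distrC; apply: rP => //; apply: mx_norm_lt => // i j.
rewrite ord1 mxE [(- x) 0 j]mxE.
have := near_nodes_nth tx (i := j); rewrite size_row_nodes => /(_ (ltn_ord j)).
rewrite mxE (nth_map ord0) ?size_enum_ord //.
by rewrite (_ : nth _ _ _ = j) //; apply: val_inj; exact: nth_enum_ord.
Qed.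

Lemma vandermonde_quotient_ext (x : 'rV[R]_k.+1) : cube I x ->
  vandermonde_quotient I g x = divdiff_ext I d (row_nodes x).
Proof.
move=> Ix; rewrite /vandermonde_quotient.
case: xgetP => [E _ /= HE|/(_ _ divdiff_ext_is_continuous_extension)] //.
have Isx := row_nodes_in Ix.
apply: (divdiff_limit_unique iI I_nondeg Isx (continuous_extension_limit HE Ix)).
exact: (divdiff_extP iI dI (leqnn k) (size_row_nodes x) Isx).
Qed.
End VandermondeQuotient.

(** * The spectral theorem for real symmetric matrices *)

Section RealSpectral.
Import complex.
Variable R : realType.

Definition dot n (u v : 'rV[R]_n) : R := (u *m v^T) 0 0.

Lemma dotE n (u v : 'rV[R]_n) : dot u v = \sum_i u 0 i * v 0 i.
Proof. by rewrite /dot mxE; apply: eq_bigr => i _; rewrite mxE. Qed.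

Lemma dotC n (u v : 'rV[R]_n) : dot u v = dot v u.
Proof. by rewrite !dotE; apply: eq_bigr => i _; rewrite mulrC. Qed.

Lemma dotDl n (u v w : 'rV[R]_n) : dot (u + v) w = dot u w + dot v w.
Proof. by rewrite /dot mulmxDl mxE. Qed.

Lemma dotZl n a (u v : 'rV[R]_n) : dot (a *: u) v = a * dot u v.
Proof. by rewrite /dot -scalemxAl mxE. Qed.

Lemma dotNl n (u v : 'rV[R]_n) : dot (- u) v = - dot u v.
Proof. by rewrite /dot mulNmx mxE. Qed.

Lemma dot_ge0 n (u : 'rV[R]_n) : 0 <= dot u u.
Proof. by rewrite dotE sumr_ge0 // => i _; rewrite -expr2 sqr_ge0. Qed.

Lemma dot_eq0 n (u : 'rV[R]_n) : dot u u = 0 -> u = 0.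
Proof.
rewrite dotE => /eqP; rewrite psumr_eq0 => [/allP H|i _]; last by rewrite -expr2 sqr_ge0.
apply/rowP => i; rewrite mxE; apply/eqP.
by have := H i (mem_index_enum _); rewrite -expr2 sqrf_eq0.
Qed.

(** Let [u + i w] be a complex eigenvector for [a + i b]. Symmetry of [A] gives
    [b (|u|^2 + |w|^2) = 0], so [b] vanishes and both [u] and [w] satisfy the
    eigenvector equation for [a]. *)
Lemma sym_real_eigenvector n (A : 'M[R]_n.+1) : sym_mx A ->
  exists l (v : 'rV[R]_n.+1), v != 0 /\ v *m A = l *: v.
Proof.
move=> sA; pose C := map_mx (real_complex R) A.
have [z] : exists z, root (char_poly C) z.
  by apply/closed_rootP; rewrite size_char_poly.
rewrite -eigenvalue_root_char => /eigenvalueP[v vC v0].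
pose u := map_mx (@complex.Re R) v; pose w := map_mx (@complex.Im R) v.
pose a := complex.Re z; pose b := complex.Im z.
have uA : u *m A = a *: u - b *: w.
  apply/rowP => j; have /(congr1 (@complex.Re R)) := congr1 (fun M : 'rV_n.+1 => M 0 j) vC.
  rewrite !mxE raddf_sum /= /a /b => H.
  transitivity (complex.Re (z * v 0 j)); last by case: (z) (v 0 j) => p q [p' q'].
  rewrite -H; apply: eq_bigr => i _; rewrite !mxE; case: (v 0 i) => p q /=.
  by rewrite mulr0 subr0.
have wA : w *m A = a *: w + b *: u.
  apply/rowP => j; have /(congr1 (@complex.Im R)) := congr1 (fun M : 'rV_n.+1 => M 0 j) vC.
  rewrite !mxE raddf_sum /= /a /b => H.
  transitivity (complex.Im (z * v 0 j)); last by case: (z) (v 0 j) => p q [p' q'] /=; ring.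
  rewrite -H; apply: eq_bigr => i _; rewrite !mxE; case: (v 0 i) => p q /=.
  by rewrite mulr0 add0r.
have AC : dot (u *m A) w = dot (w *m A) u.
  transitivity ((u *m A *m w^T)^T 0 0); first by rewrite [RHS]mxE.
  by rewrite !trmx_mul trmxK sA mulmxA.
have b0 : b = 0.
  have : b * (dot u u + dot w w) = 0.
    move: AC; rewrite uA wA !(dotDl, dotNl, dotZl) (dotC w u) => AC.
    by rewrite mulrDr; lra.
  move=> /eqP; rewrite mulf_eq0 => /orP[/eqP //|].
  rewrite paddr_eq0 ?dot_ge0 // => /andP[/eqP/dot_eq0 u0 /eqP/dot_eq0 w0].
  case/eqP: v0; apply/rowP => i; move/rowP/(_ i): u0; move/rowP/(_ i): w0.
  by rewrite !mxE; case: (v 0 i) => p q /= -> ->.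
move: uA wA; rewrite b0 !scale0r subr0 addr0 => uA wA.
have [u0|u0] := eqVneq u 0; last by exists a, u.
have [w0|w0] := eqVneq w 0; last by exists a, w.
case/eqP: v0; apply/rowP => i; move/rowP/(_ i): u0; move/rowP/(_ i): w0.
by rewrite !mxE; case: (v 0 i) => p q /= -> ->.
Qed.

(** The Householder reflection that exchanges the first basis vector and [v], or the
    identity if they coincide. *)
Lemma orth_mx_first_row n (v : 'rV[R]_n.+1) : dot v v = 1 ->
  exists2 Q : 'M[R]_n.+1, orth_mx Q & row 0 Q = v.
Proof.
move=> v1; pose e : 'rV[R]_n.+1 := delta_mx 0 0; pose w := v - e.
have ev u : dot e u = u 0 0.
  rewrite /dot /e -rowE !mxE. by [].
have e1 : dot e e = 1 by rewrite ev mxE !eqxx.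
have we : dot w e = v 0 0 - 1 by rewrite dotDl dotNl e1 dotC ev.
have ww : dot w w = 2 - 2 * v 0 0.
  rewrite dotDl dotNl !(dotC _ w) we dotDl dotNl v1 ev; ring.
have [w0|w0] := eqVneq (dot w w) 0.
  exists 1%:M; first by rewrite /orth_mx trmx1 mulmx1.
  move/dot_eq0/eqP: w0; rewrite subr_eq0 => /eqP ->.
  by rewrite rowE mulmx1.
pose c := 2 / dot w w; pose Q := 1%:M - c *: (w^T *m w).
have QT : Q^T = Q by rewrite /Q linearB linearZ /= trmx1 trmx_mul trmxK.
exists Q.
  have wwE : w *m w^T = (dot w w)%:M by rewrite [LHS]mx11_scalar.
  have SS : w^T *m w *m (w^T *m w) = dot w w *: (w^T *m w).
    by rewrite mulmxA -(mulmxA _ w) wwE mul_mx_scalar -scalemxAl.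
  rewrite /orth_mx QT /Q mulmxBl mul1mx [_ *m (1%:M - _)]mulmxBr mulmx1 -scalemxAl -scalemxAr SS.
  have cE : c * (c * dot w w) = c + c by rewrite {2}/c mulfVK // mulr_natr.
  by rewrite !scalerA -mulrA cE scalerDl opprB addrK subrK.
rewrite rowE -/e /Q mulmxBr mulmx1 -scalemxAr mulmxA.
have -> : e *m w^T = (dot w e)%:M by rewrite [LHS]mx11_scalar dotC.
rewrite mul_scalar_mx scalerA we /c ww.
have -> : 2 / (2 - 2 * v 0 0) * (v 0 0 - 1) = -1.
  by move: w0; rewrite ww => w0; field.
by rewrite scaleN1r opprK addrC subrK.
Qed.

Lemma orth_mxC n (V : 'M[R]_n) : orth_mx V -> V^T *m V = 1%:M.
Proof. by move=> /mulmx1C. Qed.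

Lemma sym_block_eigenrow n (B : 'M[R]_(1 + n)) l : B^T = B ->
  row 0 B = l *: delta_mx 0 0 -> B = block_mx l%:M 0 0 (drsubmx B).
Proof.
move=> sB B0; have row0 j : B 0 j = l * (j == 0)%:R.
  by have := congr1 (fun M : 'rV_(1 + n) => M 0 j) B0; rewrite !mxE.
have l0 (i : 'I_1) : lshift n i = 0 by apply: val_inj; rewrite ord1.
have r0 (i : 'I_n) : (rshift 1 i == 0) = false by [].
rewrite -[LHS]submxK; congr block_mx; apply/matrixP => i j.
- by rewrite mxE mxE l0 row0 l0 eqxx [RHS]mxE !ord1 eqxx mulr1.
- by rewrite mxE mxE l0 row0 r0 [RHS]mxE mulr0.
- by rewrite mxE mxE -sB mxE l0 row0 r0 [RHS]mxE mulr0.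
Qed.

(** Deflation: in an orthonormal basis that starts with an eigenvector, a symmetric
    matrix splits off the eigenvalue and a smaller symmetric block. *)
Lemma sym_diagonalizable n (A : 'M[R]_n) : sym_mx A ->
  exists V (l : 'rV[R]_n), orth_mx V /\ A = V *m diag_mx l *m V^T.
Proof.
elim: n A => [|n IH] A sA.
  exists 1%:M, 0; split; first by rewrite /orth_mx trmx1 mulmx1.
  by apply/matrixP => -[].
have [l [v [v0 vA]]] := sym_real_eigenvector sA.
have vv0 : 0 < dot v v.
  by rewrite lt_def dot_ge0 andbT; apply: contraNneq v0 => /dot_eq0 ->.
pose v1 := (Num.sqrt (dot v v))^-1 *: v.
have v11 : dot v1 v1 = 1.
  rewrite dotZl dotC dotZl mulrA -invfM -expr2 sqr_sqrtr ?ltW // mulVf //.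
  exact: lt0r_neq0.
have v1A : v1 *m A = l *: v1 by rewrite -scalemxAl vA !scalerA mulrC.
have [Q oQ Q0] := orth_mx_first_row v11.
pose B : 'M[R]_(1 + n) := Q *m A *m Q^T.
have sB : B^T = B by rewrite /B !trmx_mul trmxK sA mulmxA.
have B0 : row 0 B = l *: delta_mx 0 0.
  rewrite /B !row_mul Q0 v1A -scalemxAl -Q0 -row_mul oQ; congr (_ *: _).
  by rewrite rowE mulmx1.
have BE := sym_block_eigenrow sB B0.
have [|W [d [oW BW]]] := IH (drsubmx B).
  by rewrite /sym_mx trmx_drsub sB.
pose U : 'M[R]_(1 + n) := block_mx 1%:M 0 0 W.
have oU : U *m U^T = 1%:M.
  rewrite /U tr_block_mx mulmx_block !trmx0 trmx1 !mulmx0 !mul0mx mulmx1 !addr0 add0r.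
  by rewrite oW -scalar_mx_block.
have BU : B = U *m diag_mx (row_mx l%:M d) *m U^T.
  rewrite {1}BE diag_mx_row /U tr_block_mx !mulmx_block !trmx0 trmx1.
  rewrite !(mulmx0, mul0mx, mul1mx, mulmx1, addr0, add0r) -BW; congr block_mx.
  by apply/matrixP => i j; rewrite !ord1 !mxE.
exists (Q^T *m U), (row_mx l%:M d); split.
  rewrite /orth_mx trmx_mul trmxK mulmxA -(mulmxA _ U) oU mulmx1.
  exact: orth_mxC.
rewrite trmx_mul trmxK -!mulmxA.
have -> : U *m (diag_mx (row_mx l%:M d) *m (U^T *m Q)) = B *m Q by rewrite BU !mulmxA.
by rewrite /B -!mulmxA (orth_mxC oQ) mulmx1 mulmxA (orth_mxC oQ) mul1mx.
Qed.

Lemma char_poly_diagonalized n (V : 'M[R]_n) (l : 'rV[R]_n) : orth_mx V ->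
  char_poly (V *m diag_mx l *m V^T) = \prod_(i < n) ('X - (l 0 i)%:P).
Proof.
move=> oV.
have vC : map_mx polyC V *m map_mx polyC V^T = 1%:M by rewrite -map_mxM oV map_mx1.
rewrite /char_poly /char_poly_mx.
have -> : 'X%:M - map_mx polyC (V *m diag_mx l *m V^T) =
   map_mx polyC V *m ('X%:M - map_mx polyC (diag_mx l)) *m map_mx polyC V^T.
  rewrite mulmxBr mulmxBl !map_mxM; congr (_ - _).
  by rewrite scalar_mxC -mulmxA vC mulmx1.
rewrite !det_mulmx mulrAC -det_mulmx vC det1 mul1r.
transitivity (char_poly (diag_mx l)); first by [].
rewrite char_poly_trig ?diag_mx_is_trig //.
by apply: eq_bigr => i _; rewrite mxE eqxx mulr1n.
Qed.

Lemma eigvals_exist n (V : 'M[R]_n) (d : 'rV[R]_n) : orth_mx V ->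
  exists l, is_eigvals (V *m diag_mx d *m V^T) l.
Proof.
move=> oV; pose t := sort >=%R (row_nodes d).
have szt : size t = n by rewrite size_sort size_row_nodes.
exists (\row_i t`_i); split.
  rewrite char_poly_diagonalized //.
  transitivity (\prod_(x <- row_nodes d) ('X - x%:P)).
    by rewrite /row_nodes big_map big_enum.
  rewrite (perm_big t) /=; last by rewrite perm_sym perm_sort.
  rewrite (big_nth 0) szt big_mkord; apply: eq_bigr => i _; by rewrite mxE.
move=> i j ij; rewrite !mxE.
have := sorted_leq_nth ge_trans ge_refl 0 (sort_sorted (@ge_total _ R) (row_nodes d)).
by move=> /(_ i j); rewrite !inE -/t szt !ltn_ord; apply.
Qed.

(** Two diagonalizations have the same characteristic polynomial, so their
    eigenvalues agree up to a permutation, which is then applied to the columns of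
    the basis. *)
Lemma eigbasisP n (X : 'M[R]_n) : sym_mx X -> diagonalizes (eigbasis X) X.
Proof.
move=> sX; have [V [d [oV XE]]] := sym_diagonalizable sX.
have [lP _] : is_eigvals X (eigvals X).
  rewrite /eigvals; case: xgetP => [l _ //|H].
  by have [l] := eigvals_exist d oV; rewrite -XE => /H.
rewrite /eigbasis; case: xgetP => [U _ //|H].
have pE : perm_eq (row_nodes (eigvals X)) (row_nodes d).
  apply: prod_XsubC_eq; rewrite /row_nodes [LHS]big_map [RHS]big_map !big_enum -lP {1}XE.
  by rewrite char_poly_diagonalized.
have szd : size (row_nodes d) == n by rewrite size_row_nodes.
have /tuple_permP[p pP] : perm_eq (row_nodes (eigvals X)) (Tuple szd) by [].
have lE i : eigvals X 0 i = d 0 (p i).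
  have := congr1 (nth 0 ^~ i) pP; rewrite /= /row_nodes.
  rewrite (nth_map i) ?size_enum_ord // nth_ord_enum => ->.
  rewrite (nth_map i) ?size_enum_ord // nth_ord_enum (tnth_nth 0) /=.
  by rewrite (nth_map i) ?size_enum_ord // nth_ord_enum.
case: (H (col_perm p V)); split.
  rewrite /orth_mx -oV; apply/matrixP => i j; rewrite !mxE [RHS](reindex_inj (@perm_inj _ p)) /=.
  by apply: eq_bigr => a _; rewrite !mxE.
rewrite {1}XE; apply/matrixP => i j; rewrite !mxE (reindex_inj (@perm_inj _ p)) /=.
by apply: eq_bigr => a _; rewrite !mul_mx_diag !mxE lE.
Qed.
End RealSpectral.

(** * Spectral sums *)

Section SpectralSums.
Variables (R : realType) (n : nat).
Implicit Types (f phi psi : seq R -> R) (U : 'M[R]_n) (h : 'M[R]_n).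

(** Eigenvectors, as columns of a matrix, with their eigenvalues: the summands of a
    spectral sum depend on the eigenbasis and not only on the diagonalized matrix. *)
Definition spectral_data : Type := ('M[R]_n * 'rV[R]_n)%type.
Implicit Types (D Y Z : spectral_data) (s : seq ('M[R]_n * spectral_data)).

Definition spectral_mx D : 'M[R]_n := D.1 *m diag_mx D.2 *m D.1^T.

Definition spectral_in (I : set R) D := orth_mx D.1 /\ forall i, I (D.2 0 i).

Definition eigenproj U i : 'M[R]_n := col i U *m (col i U)^T.

Lemma eigenprojE U i a b : eigenproj U i a b = U a i * U b i.
Proof. by rewrite mxE big_ord1 !mxE. Qed.

Lemma sum_eigenproj U : orth_mx U -> \sum_i eigenproj U i = 1%:M.
Proof.
move=> <-; apply/matrixP => a b; rewrite summxE mxE.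
by apply: eq_bigr => i _; rewrite eigenprojE mxE.
Qed.

Lemma spectral_mxE D : spectral_mx D = \sum_i D.2 0 i *: eigenproj D.1 i.
Proof.
apply/matrixP => a b; rewrite summxE mxE; apply: eq_bigr => i _.
by rewrite mul_mx_diag !mxE big_ord1 !mxE; ring.
Qed.

Lemma eigenproj_mul U i j : orth_mx U ->
  eigenproj U i *m eigenproj U j = (i == j)%:R *: eigenproj U i.
Proof.
move=> /orth_mxC UU; apply/matrixP => a b; rewrite mxE.
transitivity (U a i * U b j * (U^T *m U) i j); last first.
  rewrite UU !mxE big_ord1 !mxE; case: eqP => [->|_]; rewrite ?mulr1 ?mul1r //.
  by rewrite mulr0 mul0r.
rewrite mxE mulr_sumr; apply: eq_bigr => c _; rewrite !eigenprojE !mxE; ring.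
Qed.

Lemma eigenproj_spectral D i : orth_mx D.1 ->
  eigenproj D.1 i *m spectral_mx D = D.2 0 i *: eigenproj D.1 i.
Proof.
move=> oD; rewrite spectral_mxE mulmx_sumr (bigD1 i) //= big1 => [|j ji].
  by rewrite addr0 -scalemxAr eigenproj_mul // eqxx scale1r.
by rewrite -scalemxAr eigenproj_mul // eq_sym (negbTE ji) scale0r scaler0.
Qed.

Lemma spectral_eigenproj D i : orth_mx D.1 ->
  spectral_mx D *m eigenproj D.1 i = D.2 0 i *: eigenproj D.1 i.
Proof.
move=> oD; rewrite spectral_mxE mulmx_suml (bigD1 i) //= big1 => [|j ji].
  by rewrite addr0 -scalemxAl eigenproj_mul // eqxx scale1r.
by rewrite -scalemxAl eigenproj_mul // (negbTE ji) scale0r scaler0.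
Qed.

(** This commutation is what turns differences of matrices into differences of
    eigenvalues. *)
Lemma eigenproj_difference Z Y i j : orth_mx Z.1 -> orth_mx Y.1 ->
  eigenproj Z.1 i *m (spectral_mx Z - spectral_mx Y) *m eigenproj Y.1 j =
  (Z.2 0 i - Y.2 0 j) *: (eigenproj Z.1 i *m eigenproj Y.1 j).
Proof.
move=> oZ oY; rewrite mulmxBr mulmxBl eigenproj_spectral // -mulmxA spectral_eigenproj //.
by rewrite -scalemxAl -scalemxAr scalerBl.
Qed.

Lemma trmx_eigenproj U i : (eigenproj U i)^T = eigenproj U i.
Proof. by rewrite trmx_mul trmxK. Qed.

(** On the list of the pairs [(h_r, D_r)], the sum of the products
    [f (l_0, l_1, ...) h_0 P_0 h_1 P_1 ...] over all choices of an eigenprojection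
    [P_r] of [D_r] with eigenvalue [l_r]: a multiple operator integral on finite
    spectra, in which every slot may carry its own matrix. *)
Fixpoint chain f s : 'M[R]_n :=
  if s is (h, D) :: s' then
    h *m \sum_i eigenproj D.1 i *m chain (fun t => f (D.2 0 i :: t)) s'
  else (f [::])%:M.

Fixpoint data_in (I : set R) s : Prop :=
  if s is (h, D) :: s' then spectral_in I D /\ data_in I s' else True.

Lemma eq_chain I f f' s : data_in I s ->
  (forall t, size t = size s -> nodes_in I t -> f t = f' t) ->
  chain f s = chain f' s.
Proof.
elim: s f f' => [|[h D] s IH] f f' /= => [_ ->//|[[_ ID] Is] ff'].
congr (_ *m _); apply: eq_bigr => i _; congr (_ *m _); apply: IH => // t st It.
by apply: ff'; rewrite /= ?st //; apply/nodes_in_cons.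
Qed.

Lemma chain_linear a b f f' s :
  chain (fun t => a * f t + b * f' t) s = a *: chain f s + b *: chain f' s.
Proof.
elim: s f f' => [|[h D] s IH] f f' /=; first by rewrite raddfD /= -!scale_scalar_mx.
rewrite !scalemxAr -mulmxDr !scaler_sumr -big_split /=.
congr (_ *m _); apply: eq_bigr => i _.
by rewrite IH mulmxDr !scalemxAr.
Qed.

Lemma chainB f f' s : chain (fun t => f t - f' t) s = chain f s - chain f' s.
Proof.
rewrite -[chain f s]scale1r -scaleN1r -chain_linear.
by congr chain; apply/funext => t; rewrite mul1r mulN1r.
Qed.

Lemma chainZ a f s : chain (fun t => a * f t) s = a *: chain f s.
Proof.
rewrite -[RHS]addr0 -(scale0r (chain f s)) -chain_linear.
by congr chain; apply/funext => t; rewrite mul0r addr0.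
Qed.

(** Inserting both resolutions of the identity makes the two sums comparable
    term by term. *)
Lemma spectral_sum_difference U U' (N N' : 'I_n -> 'M[R]_n) : orth_mx U -> orth_mx U' ->
  \sum_i eigenproj U i *m N i - \sum_j eigenproj U' j *m N' j =
  \sum_i \sum_j eigenproj U i *m eigenproj U' j *m (N i - N' j).
Proof.
move=> oU oU'.
have -> : \sum_i eigenproj U i *m N i = \sum_i \sum_j eigenproj U i *m eigenproj U' j *m N i.
  by apply: eq_bigr => i _; rewrite -mulmx_suml -mulmx_sumr sum_eigenproj // mulmx1.
have -> : \sum_j eigenproj U' j *m N' j = \sum_i \sum_j eigenproj U i *m eigenproj U' j *m N' j.
  rewrite exchange_big; apply: eq_bigr => j _.
  by rewrite -mulmx_suml -mulmx_suml sum_eigenproj // mul1mx.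
rewrite -sumrB; apply: eq_bigr => i _; rewrite -sumrB; apply: eq_bigr => j _.
by rewrite mulmxBr.
Qed.

(** Exchanging [Z] for [Y] in one slot creates exactly one new slot, filled with
    [Z - Y]: the difference of the eigenvalues, which the commutation relation
    produces, is the factor that the divided difference [psi] lacks. *)
Lemma chain_head I phi psi h Z Y s : spectral_in I Z -> spectral_in I Y -> data_in I s ->
  (forall x x' t, I x -> I x' -> nodes_in I t -> size t = size s ->
    phi (x :: t) - phi (x' :: t) = (x - x') * psi [:: x, x' & t]) ->
  chain phi ((h, Z) :: s) - chain phi ((h, Y) :: s) =
  chain psi [:: (h, Z), (spectral_mx Z - spectral_mx Y, Y) & s].
Proof.
move=> [oZ IZ] [oY IY] Is dd /=; rewrite -mulmxBr; congr (_ *m _).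
rewrite spectral_sum_difference //; apply: eq_bigr => i _.
rewrite mulmxA mulmx_sumr; apply: eq_bigr => j _.
rewrite mulmxA eigenproj_difference // -scalemxAl scalemxAr; congr (_ *m _).
rewrite -chainB -chainZ; apply: eq_chain Is _ => t st It.
exact: dd.
Qed.

(** Exchange the slots one after the other. *)
Lemma chain_telescope I phi psi (hs : seq 'M[R]_n) Z Y : spectral_in I Z -> spectral_in I Y ->
  (forall t1 x x' t2, nodes_in I t1 -> I x -> I x' -> nodes_in I t2 ->
    (size t1 + size t2).+1 = size hs ->
    phi (t1 ++ x :: t2) - phi (t1 ++ x' :: t2) = (x - x') * psi (t1 ++ [:: x, x' & t2])) ->
  chain phi [seq (h, Z) | h <- hs] - chain phi [seq (h, Y) | h <- hs] =
  \sum_(m < size hs) chain psi ([seq (h, Z) | h <- take m.+1 hs] ++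
    (spectral_mx Z - spectral_mx Y, Y) :: [seq (h, Y) | h <- drop m.+1 hs]).
Proof.
move=> IZ IY; elim: hs phi psi => [|h hs IH] phi psi dd; first by rewrite big_ord0 subrr.
have IYs : data_in I [seq (h, Y) | h <- hs] by elim: (hs) => //=.
rewrite -[LHS](subrKA (chain phi ((h, Z) :: [seq (h, Y) | h <- hs]))) big_ord_recl addrC.
congr (_ + _).
  rewrite (chain_head (I := I) (psi := psi)) //; first by rewrite /= take0 drop0.
  move=> x x' t Ix Ix' It; rewrite size_map => st.
  by apply: (dd [::]) => //=; rewrite add0n st.
rewrite /= -mulmxBr -sumrB -/(size hs).
have IHi i : chain (fun t => phi (Z.2 0 i :: t)) [seq (h, Z) | h <- hs] -
    chain (fun t => phi (Z.2 0 i :: t)) [seq (h, Y) | h <- hs] =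
    \sum_(m < size hs) chain (fun t => psi (Z.2 0 i :: t)) ([seq (h, Z) | h <- take m.+1 hs] ++
    (spectral_mx Z - spectral_mx Y, Y) :: [seq (h, Y) | h <- drop m.+1 hs]).
  apply: IH => t1 x x' t2 It1 Ix Ix' It2 sz.
  apply: (dd (Z.2 0 i :: t1)) => //=; last by rewrite -sz.
  by apply/nodes_in_cons; split=> //; case: IZ.
under [X in _ *m X = _]eq_bigr do rewrite -mulmxBr IHi mulmx_sumr.
by rewrite exchange_big mulmx_sumr.
Qed.

Lemma chain_rcons f s h D :
  chain f (rcons s (h, D)) =
  \sum_i chain (fun t => f (rcons t (D.2 0 i))) s *m h *m eigenproj D.1 i.
Proof.
elim: s f => [|[h' D'] s IH] f /=.
  rewrite mulmx_sumr; apply: eq_bigr => i _.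
  by rewrite mul_mx_scalar mul_scalar_mx -!scalemxAl -scalemxAr.
under eq_bigr do rewrite IH mulmx_sumr.
rewrite exchange_big mulmx_sumr; apply: eq_bigr => j _.
rewrite -!mulmxA mulmx_suml; congr (_ *m _); apply: eq_bigr => i _.
by rewrite !mulmxA.
Qed.

(** The leading identity matrix provides the projection to the left of the first
    argument. *)
Definition chain1 f D (hs : seq 'M[R]_n) := chain f ((1%:M, D) :: [seq (h, D) | h <- hs]).

Lemma chain1_cons f D h hs : chain1 f D (h :: hs) =
  \sum_i eigenproj D.1 i *m h *m chain1 (fun t => f (D.2 0 i :: t)) D hs.
Proof.
rewrite /chain1 /= mul1mx; apply: eq_bigr => i _.
by rewrite mul1mx mulmxA.
Qed.

Lemma chain1_rcons f D h hs : chain1 f D (rcons hs h) =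
  \sum_i chain1 (fun t => f (rcons t (D.2 0 i))) D hs *m h *m eigenproj D.1 i.
Proof. by rewrite /chain1 map_rcons -rcons_cons chain_rcons. Qed.

Lemma trmx_chain1 f D hs : (forall h, h \in hs -> h^T = h) ->
  (chain1 f D hs)^T = chain1 (fun t => f (rev t)) D (rev hs).
Proof.
elim: hs f => [|h hs IH] f sh.
  rewrite /chain1 /= !mul1mx linear_sum /=; apply: eq_bigr => i _.
  by rewrite trmx_mul trmx_eigenproj tr_scalar_mx scalar_mxC.
rewrite chain1_cons rev_cons chain1_rcons linear_sum /=; apply: eq_bigr => i _.
rewrite trmx_mul [(_ *m h)^T]trmx_mul trmx_eigenproj (sh h) ?mem_head // IH.
  rewrite mulmxA; congr (chain1 _ _ _ *m _ *m _).
  by apply/funext => t; rewrite rev_rcons.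
by move=> h' h'hs; apply: sh; rewrite inE h'hs orbT.
Qed.

(** The sum depends on the matrix only, not on the eigenbasis: compare the two
    diagonalizations through a difference quotient of [f]. *)
Lemma chain_basis_independent I f Z Y (hs : seq 'M[R]_n) :
  spectral_in I Z -> spectral_in I Y -> spectral_mx Z = spectral_mx Y ->
  chain f [seq (h, Z) | h <- hs] = chain f [seq (h, Y) | h <- hs].
Proof.
move=> IZ IY ZY; elim: hs f => [//|h hs IH] f.
have IYs : data_in I [seq (h, Y) | h <- hs] by elim: (hs) => //=.
transitivity (chain f ((h, Z) :: [seq (h, Y) | h <- hs])).
  by rewrite /=; congr (_ *m _); apply: eq_bigr => i _; rewrite IH.
apply/eqP; rewrite -subr_eq0; apply/eqP.
pose psi (t : seq R) := if t is x :: x' :: t' then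
  (f (x :: t') - f (x' :: t')) / (x - x') else 0.
rewrite (chain_head (I := I) (psi := psi)) //.
  rewrite /= ZY subrr big1 ?mulmx0 // => i _.
  by rewrite mul0mx mulmx0.
move=> x x' t _ _ _ _ /=; have [->|xx'] := eqVneq x x'; first by rewrite !subrr mul0r.
by rewrite mulrC mulfVK // subr_eq0.
Qed.
End SpectralSums.

(** * Continuity of spectral sums *)

Section SpectralEstimates.
Variables (R : realType) (n : nat).
Implicit Types (f : seq R -> R) (U h : 'M[R]_n) (D : spectral_data R n).
Implicit Types (s : seq ('M[R]_n * spectral_data R n)).
Implicit Types (w : seq ('M[R]_n * (spectral_data R n * spectral_data R n))).
Local Notation c := (n%:R : R).

Lemma mulmx_norm (A B : 'M[R]_n) : `|A *m B| <= c * `|A| * `|B|.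
Proof.
apply: mx_norm_le => [|i j]; first by rewrite !mulr_ge0.
rewrite mxE; apply: (le_trans (ler_norm_sum _ _ _)).
apply: (@le_trans _ _ (\sum_(l < n) `|A| * `|B|)); last first.
  by rewrite sumr_const card_ord -mulrA mulr_natl.
by apply: ler_sum => l _; rewrite normrM ler_pM // mx_entry_le_norm.
Qed.

Lemma scalar_mx_norm (a : R) : `|a%:M : 'M[R]_n| <= `|a|.
Proof.
by apply: mx_norm_le => // i j; rewrite mxE; case: eqP => _; rewrite ?mulr1n ?mulr0n ?normr0.
Qed.

Lemma orth_entry U i j : orth_mx U -> `|U i j| <= 1.
Proof.
move=> /(congr1 (fun M : 'M[R]_n => M i i)); rewrite !mxE eqxx mulr1n (bigD1 j) //= mxE => E.
rewrite -(@ler_pXn2r _ 2) ?nnegrE // expr1n -normrX ger0_norm ?sqr_ge0 // expr2 -E lerDl.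
by apply: sumr_ge0 => l _; rewrite mxE -expr2 sqr_ge0.
Qed.

Lemma eigenproj_norm U i : orth_mx U -> `|eigenproj U i| <= 1.
Proof.
move=> oU; apply: mx_norm_le => // a b; rewrite eigenprojE normrM.
by rewrite -[leRHS]mulr1 ler_pM // orth_entry.
Qed.

Lemma spectral_sum_norm U h (N : 'I_n -> 'M[R]_n) b : orth_mx U -> 0 <= b ->
  (forall i, `|N i| <= b) -> `|h *m \sum_i eigenproj U i *m N i| <= c ^+ 3 * `|h| * b.
Proof.
move=> oU b0 Nb; apply: (le_trans (mulmx_norm _ _)).
have -> : c ^+ 3 * `|h| * b = c * `|h| * (c * (c * b)) by ring.
rewrite ler_wpM2l ?mulr_ge0 //; apply: (le_trans (ler_norm_sum _ _ _)).
apply: (@le_trans _ _ (\sum_(i < n) c * b)); last first.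
  by rewrite sumr_const card_ord [leRHS]mulr_natl.
apply: ler_sum => i _; apply: (le_trans (mulmx_norm _ _)).
by apply: ler_pM; rewrite ?mulr_ge0 ?ler_piMr ?eigenproj_norm.
Qed.

Lemma chain_bound (S : set R) f s B : data_in S s -> 0 <= B ->
  (forall t, size t = size s -> nodes_in S t -> `|f t| <= B) ->
  `|chain f s| <= (c ^+ 3) ^+ size s * B * \prod_(x <- s) `|x.1|.
Proof.
move=> + B0; elim: s f => [|[h D] s IH] f /= => [_ fB|[[oD SD] Ss] fB].
  rewrite big_nil expr0 mulr1 mul1r; apply: (le_trans (scalar_mx_norm _)).
  exact: fB.
rewrite big_cons /= exprS.
have -> : c ^+ 3 * (c ^+ 3) ^+ size s * B * (`|h| * \prod_(x <- s) `|x.1|) =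
  c ^+ 3 * `|h| * ((c ^+ 3) ^+ size s * B * \prod_(x <- s) `|x.1|) by ring.
apply: spectral_sum_norm => //.
  by rewrite !mulr_ge0 ?exprn_ge0 // prodr_ge0.
move=> i; apply: IH => // t st It; apply: fB; rewrite /= ?st //.
exact/nodes_in_cons.
Qed.

Definition left_data w := [seq (x.1, x.2.1) | x <- w].
Definition right_data w := [seq (x.1, x.2.2) | x <- w].

(** Products of spectral projections of two close matrices are small unless the
    eigenvalues are close: this replaces any tracking of eigenvectors. *)
Lemma eigenproj_mul_norm (Z Y : spectral_data R n) i j r : orth_mx Z.1 -> orth_mx Y.1 -> 0 < r ->
  r <= `|Z.2 0 i - Y.2 0 j| ->
  `|eigenproj Z.1 i *m eigenproj Y.1 j| <= c ^+ 2 * `|spectral_mx Z - spectral_mx Y| / r.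
Proof.
move=> oZ oY r0 rij; rewrite ler_pdivlMr // mulrC.
apply: (@le_trans _ _ `|(Z.2 0 i - Y.2 0 j) *: (eigenproj Z.1 i *m eigenproj Y.1 j)|).
  by rewrite normrZ ler_wpM2r.
rewrite -eigenproj_difference //; apply: (le_trans (mulmx_norm _ _)).
have := eigenproj_norm i oZ; have := eigenproj_norm j oY => H1 H2.
rewrite -mulrA expr2 -mulrA ler_wpM2l //.
rewrite -[leRHS]mulr1 ler_pM //; apply: (le_trans (mulmx_norm _ _)).
by rewrite -mulrA ler_wpM2l // ler_piMl.
Qed.

(** Compare the two chains pair of eigenvalues by pair of eigenvalues. A pair at
    distance at least [theta] has a product of projections of size at most a
    multiple of [theta ^+ 2 / theta], while the values of the functions are bounded
    by [B]; the other pairs are governed by the modulus of continuity [eta]. *)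
Lemma chain_uniformly_continuous m : exists2 K : R, 0 <= K &
  forall w f f' (S S' : set R) (B eta theta : R), size w = m -> 0 <= B -> 0 <= eta -> 0 < theta ->
  data_in S (left_data w) -> data_in S' (right_data w) ->
  (forall x, x \in w -> `|spectral_mx x.2.1 - spectral_mx x.2.2| <= theta ^+ 2) ->
  (forall t, size t = m -> nodes_in S t -> `|f t| <= B) ->
  (forall t, size t = m -> nodes_in S' t -> `|f' t| <= B) ->
  (forall t t', size t = m -> nodes_in S t -> nodes_in S' t' -> near_nodes theta t t' ->
     `|f t - f' t'| <= eta) ->
  `|chain f (left_data w) - chain f' (right_data w)| <=
    K * (eta + B * theta) * \prod_(x <- w) `|x.1|.
Proof.
elim: m => [|m [K K0 IH]].
  exists 1 => // -[|//] f f' S S' B eta theta _ B0 e0 t0 _ _ _ _ _ ff' /=.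
  rewrite big_nil mulr1 mul1r -raddfB /=; apply: (le_trans (scalar_mx_norm _)).
  by rewrite (le_trans (ff' [::] [::] _ _ _ _)) // lerDl mulr_ge0 // ltW.
pose b := (c ^+ 3) ^+ m.
have b0 : 0 <= b by rewrite !exprn_ge0.
exists (c ^+ 3 * (c ^+ 2 * K + 2 * c ^+ 3 * b)).
  by rewrite mulr_ge0 ?addr_ge0 ?mulr_ge0 ?exprn_ge0.
move=> [//|[h [D D']] w] f f' S S' B eta theta [szw] B0 e0 t0 /= [[oD SD] Sw] [[oD' SD'] Sw'].
move=> close fB f'B ff'; rewrite -mulmxBr spectral_sum_difference // big_cons /=.
set P := \prod_(x <- w) _.
have P0 : 0 <= P by rewrite prodr_ge0.
pose N i := chain (fun t => f (D.2 0 i :: t)) (left_data w).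
pose N' j := chain (fun t => f' (D'.2 0 j :: t)) (right_data w).
have NB i : `|N i| <= b * B * P.
  have := @chain_bound S (fun t => f (D.2 0 i :: t)) (left_data w) B Sw B0.
  rewrite /left_data size_map szw big_map; apply => t st It.
  by apply: fB; rewrite /= ?st //; apply/nodes_in_cons.
have N'B j : `|N' j| <= b * B * P.
  have := @chain_bound S' (fun t => f' (D'.2 0 j :: t)) (right_data w) B Sw' B0.
  rewrite /right_data size_map szw big_map; apply => t st It.
  by apply: f'B; rewrite /= ?st //; apply/nodes_in_cons.
have term i j : `|eigenproj D.1 i *m eigenproj D'.1 j *m (N i - N' j)| <=
    (c ^+ 2 * K + 2 * c ^+ 3 * b) * (eta + B * theta) * P.
  have Bt0 : 0 <= B * theta by rewrite mulr_ge0 // ltW.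
  apply: (le_trans (mulmx_norm _ _)).
  have [near|far] := ltrP `|D.2 0 i - D'.2 0 j| theta.
    apply: (@le_trans _ _ (c * c * (K * (eta + B * theta) * P))).
      rewrite ler_pM ?mulr_ge0 //.
        rewrite ler_wpM2l // (le_trans (mulmx_norm _ _)) //.
        have := eigenproj_norm i oD; have := eigenproj_norm j oD' => H1 H2.
        by rewrite -mulrA ler_piMr // -[leRHS]mulr1 ler_pM.
      apply: (IH w _ _ S S') => //.
      - by move=> x xw; apply: close; rewrite inE xw orbT.
      - by move=> t st It; apply: fB; rewrite /= ?st //; apply/nodes_in_cons.
      - by move=> t st It; apply: f'B; rewrite /= ?st //; apply/nodes_in_cons.
      move=> t t' st It It' tt'; apply: ff'; rewrite /= ?st ?near //; exact/nodes_in_cons.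
    rewrite -subr_ge0.
    have -> : (c ^+ 2 * K + 2 * c ^+ 3 * b) * (eta + B * theta) * P -
      c * c * (K * (eta + B * theta) * P) = 2 * c ^+ 3 * b * (eta + B * theta) * P by ring.
    by rewrite !mulr_ge0 ?addr_ge0 ?exprn_ge0.
  apply: (@le_trans _ _ (c * (c ^+ 2 * theta) * (2 * (b * B * P)))).
    rewrite ler_pM ?mulr_ge0 //.
      rewrite ler_wpM2l // (le_trans (eigenproj_mul_norm oD oD' t0 far)) //.
      rewrite -mulrA ler_wpM2l ?exprn_ge0 // ler_pdivrMr // -expr2.
      by apply: (close (h, (D, D'))); rewrite mem_head.
    by rewrite (le_trans (ler_normB _ _)) // mulr_natl mulr2n lerD.
  rewrite -subr_ge0.
  have -> : (c ^+ 2 * K + 2 * c ^+ 3 * b) * (eta + B * theta) * P -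
      c * (c ^+ 2 * theta) * (2 * (b * B * P)) =
    c ^+ 2 * K * (eta + B * theta) * P + 2 * c ^+ 3 * b * eta * P by ring.
  by rewrite addr_ge0 // !mulr_ge0 ?addr_ge0 ?exprn_ge0.
apply: (le_trans (mulmx_norm _ _)).
set T := (c ^+ 2 * K + 2 * c ^+ 3 * b) * (eta + B * theta) * P in term.
have -> : c ^+ 3 * (c ^+ 2 * K + 2 * c ^+ 3 * b) * (eta + B * theta) * (`|h| * P) =
  c * `|h| * (c * (c * T)) by rewrite /T; ring.
rewrite ler_wpM2l ?mulr_ge0 //; apply: (le_trans (ler_norm_sum _ _ _)).
apply: (@le_trans _ _ (\sum_(i < n) c * T)); last by rewrite sumr_const card_ord [leRHS]mulr_natl.
apply: ler_sum => i _; apply: (le_trans (ler_norm_sum _ _ _)).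
apply: (@le_trans _ _ (\sum_(i < n) T)); last by rewrite sumr_const card_ord [leRHS]mulr_natl.
exact: ler_sum.
Qed.

(** Since the rank one projections have trace 1, they cannot be sums of small
    products. *)
Lemma spectrum_close (Z Y : spectral_data R n) r i : orth_mx Z.1 -> orth_mx Y.1 -> 0 < r ->
  c ^+ 4 * `|spectral_mx Z - spectral_mx Y| < r ->
  exists j, `|Z.2 0 i - Y.2 0 j| < r.
Proof.
move=> oZ oY r0 close; apply: contrapT => H.
have far j : r <= `|Z.2 0 i - Y.2 0 j|.
  by rewrite leNgt; apply/negP => ?; apply: H; exists j.
pose q := c ^+ 2 * `|spectral_mx Z - spectral_mx Y| / r.
have : (1 : R) <= c * (c * q).
  have tr1 : \tr (eigenproj Z.1 i) = 1.
    rewrite /eigenproj mxtrace_mulC /mxtrace big_ord1.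
    have := congr1 (fun M : 'M[R]_n => M i i) (orth_mxC oZ); rewrite !mxE eqxx mulr1n => <-.
    by apply: eq_bigr => j _; rewrite !mxE.
  rewrite -[leLHS]tr1.
  rewrite -[eigenproj Z.1 i]mulmx1 -(sum_eigenproj oY) mulmx_sumr.
  rewrite (le_trans (ler_norm _)) // /mxtrace (le_trans (ler_norm_sum _ _ _)) //.
  apply: (@le_trans _ _ (\sum_(a < n) c * q)); last by rewrite sumr_const card_ord [leRHS]mulr_natl.
  apply: ler_sum => a _.
  rewrite summxE (le_trans (ler_norm_sum _ _ _)) //.
  apply: (@le_trans _ _ (\sum_(j < n) q)); last by rewrite sumr_const card_ord [leRHS]mulr_natl.
  apply: ler_sum => j _.
  by rewrite (le_trans (mx_entry_le_norm _ _ _)) // eigenproj_mul_norm.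
rewrite leNgt /q !mulrA ltr_pdivrMr // mul1r => /negP; apply.
by apply: le_lt_trans close; rewrite le_eqVlt; apply/orP; left; apply/eqP; ring.
Qed.
End SpectralEstimates.

(** * Cycles and arrangements *)

Section Arrangements.

Definition arrangements j : seq (seq nat) := permutations (iota 0 j).

Definition insert_at (T : Type) m (x : T) s := take m s ++ x :: drop m s.

Lemma perm_insert_at (T : eqType) m (x : T) s : perm_eq (insert_at m x s) (x :: s).
Proof. by rewrite /insert_at -cat1s perm_catCA /= cat_take_drop. Qed.

Lemma arrangementP j s : s \in arrangements j ->
  [/\ uniq s, size s = j & forall m, (m \in s) = (m < j)%N].
Proof.
rewrite mem_permutations => ps; split; first by rewrite (perm_uniq ps) iota_uniq.
  by rewrite (perm_size ps) size_iota.
by move=> m; rewrite (perm_mem ps) mem_iota.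
Qed.

Lemma iota_last j : perm_eq (iota 0 j.+1) (j :: iota 0 j).
Proof. by rewrite -[j.+1]addn1 iotaD /= add0n cats1 perm_rcons. Qed.

(** The arrangement is recovered from the position of [j] and from what remains once
    [j] is removed. *)
Lemma arrangementsS j : perm_eq (arrangements j.+1)
  [seq insert_at m j s | s <- arrangements j, m <- iota 0 j.+1].
Proof.
have idx s m : s \in arrangements j -> m \in iota 0 j.+1 -> index j (insert_at m j s) = m.
  move=> /arrangementP[us szs js]; rewrite mem_iota ltnS => /= mj.
  rewrite /insert_at index_cat ifN; last first.
    by apply/negP => /mem_take; rewrite js ltnn.
  by rewrite /= eqxx addn0 size_take_min szs; apply/minn_idPl.
have rm s m : s \in arrangements j -> m \in iota 0 j.+1 -> rem j (insert_at m j s) = s.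
  move=> sj mj; rewrite remE idx // /insert_at.
  have szt : size (take m s) = m.
    have [_ szs _] := arrangementP sj; move: mj; rewrite mem_iota ltnS => /= mj.
    by rewrite size_take_min szs; apply/minn_idPl.
  rewrite take_size_cat // drop_cat szt ltnNge leqnSn /= subSnn /= drop0.
  exact: cat_take_drop.
apply: uniq_perm; first exact: permutations_uniq.
  apply: allpairs_uniq; [exact: permutations_uniq|exact: iota_uniq|].
  move=> [s m] [s' m'] /allpairsP[[a b] [aj bj [sE mE]]].
  move=> /allpairsP[[a' b'] [a'j b'j [s'E m'E]]]; rewrite {s}sE {m}mE {s'}s'E {m'}m'E /=.
  by move=> E; congr pair; [rewrite -(rm a b) // E rm|rewrite -(idx a b) // E idx].
move=> s; apply/idP/allpairsP => [sj|[[s' m] /= [sj mj ->]]]; last first.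
  rewrite mem_permutations perm_sym (perm_trans (iota_last j)) // perm_sym.
  rewrite (perm_trans (perm_insert_at _ _ _)) // perm_cons -mem_permutations //.
have [us szs js] := arrangementP sj.
have jins : j \in s by rewrite js.
exists (rem j s, index j s); split; rewrite /fst /snd.
- rewrite mem_permutations -(perm_cons j) perm_sym -(permPr (perm_to_rem jins)) perm_sym.
  by rewrite -(permPr (iota_last j)) -mem_permutations.
- by rewrite mem_iota /= -szs add0n index_mem.
rewrite remE /insert_at take_size_cat; last by rewrite size_takel // ltnW // index_mem.
rewrite drop_size_cat; last by rewrite size_takel // ltnW // index_mem.
by rewrite -{1}(cat_take_drop (index j s) s) (drop_index jins).
Qed.

(** A cycle written down from its last point onwards, that point being omitted. *)
Definition orbit_list k (sigma : 'S_k.+1) : seq nat :=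
  [seq nat_of_ord i | i <- traject sigma (sigma ord_max) k].

Lemma one_cycleP k (sigma : 'S_k.+1) : one_cycle sigma ->
  perm_eq (traject sigma ord_max k.+1) (enum 'I_k.+1) /\ iter k.+1 sigma ord_max = ord_max.
Proof.
rewrite /one_cycle => /cards1P[A pA].
have full i : porbit sigma i = A.
  by apply/set1P; rewrite -pA; apply/imsetP; exists i.
have pT : porbit sigma ord_max = [set: 'I_k.+1]%SET.
  by apply/setP => i; rewrite inE -eq_porbit_mem !full eqxx.
have card_k : #|porbit sigma ord_max| = k.+1 by rewrite pT cardsT card_ord.
split; last by have := iter_porbit sigma ord_max; rewrite card_k.
apply: uniq_perm; last 2 first.
- exact: enum_uniq.
- move=> i; have := porbit_traject sigma ord_max i; rewrite card_k => <-.
  by rewrite pT !inE mem_enum.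
by have := uniq_traject_porbit sigma ord_max; rewrite card_k.
Qed.

Lemma perm_iota_rcons k (t : seq 'I_k.+1) : perm_eq (ord_max :: t) (enum 'I_k.+1) ->
  perm_eq (map val t) (iota 0 k).
Proof.
move=> /(perm_map val); rewrite val_enum_ord /= => H.
by rewrite -(perm_cons k) (perm_trans H) // iota_last.
Qed.

Lemma orbit_list_inj k : {in @one_cycle k.+1 &, injective (@orbit_list k)}.
Proof.
move=> s t ss tt; rewrite /orbit_list => /(inj_map val_inj) E.
have [ps is_] := one_cycleP ss; have [pt it_] := one_cycleP tt.
have itE i : (i <= k)%N -> iter i s ord_max = iter i t ord_max.
  move=> ik; rewrite -(@nth_traject _ s i k.+1) // -(@nth_traject _ t i k.+1) //.
  by rewrite !trajectS E.
apply/permP => r.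
have : r \in traject s ord_max k.+1 by rewrite (perm_mem ps) mem_enum.
move=> /trajectP[i ik ->].
rewrite [in RHS]itE // -[LHS]/(iter i.+1 s ord_max) -[RHS]/(iter i.+1 t ord_max).
move: ik; rewrite ltnS leq_eqVlt => /orP[/eqP ->|ik]; first by rewrite is_ it_.
exact: itE.
Qed.

(** Conversely an arrangement, preceded by the last point, is a cyclic list, and
    passing to the next entry of that list is the permutation it comes from. *)
Lemma orbit_list_perm k :
  perm_eq [seq orbit_list s | s <- enum (@one_cycle k.+1)] (arrangements k).
Proof.
apply: uniq_perm; last first.
- move=> s; rewrite mem_permutations; apply/mapP/idP => [[sigma]|ps].
    rewrite mem_enum => /one_cycleP[pe _ ->]; exact: perm_iota_rcons.
  (* [sigma] moves each entry of the cyclic list [c] to the next one. *)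
  pose t := [seq inord m : 'I_k.+1 | m <- s]; pose c := ord_max :: t.
  have st : map val t = s.
    rewrite -map_comp -[RHS]map_id; apply/eq_in_map => m.
    by rewrite (perm_mem ps) mem_iota /= add0n => mk; rewrite inordK // ltnW.
  have pc : perm_eq (map val c) (iota 0 k.+1).
    by rewrite perm_sym (perm_trans (iota_last k)) // perm_sym /= st perm_cons.
  have uc : uniq c by rewrite -(map_inj_uniq val_inj) (perm_uniq pc) iota_uniq.
  have szt : size t = k by rewrite size_map (perm_size ps) size_iota.
  pose sigma : 'S_k.+1 := @perm 'I_k.+1 (next c) (can_inj (prev_next uc)).
  have tE : t = traject sigma (sigma ord_max) k.
    have : fpath (next c) ord_max t.
      by have := cycle_next uc; rewrite /c /= rcons_path => /andP[].
    have sE x : sigma x = next c x by exact: permE.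
    have trE m x : traject (next c) x m = traject sigma x m.
      by elim: m x => //= m IH x; rewrite sE IH.
    move=> /fpathE E; transitivity (traject (next c) (next c ord_max) k).
      by have := E; rewrite szt.
    by rewrite trE; congr traject; rewrite sE.
  exists sigma; last by rewrite /orbit_list -tE st.
  rewrite mem_enum unfold_in /one_cycle.
  have orb r : porbit sigma r = porbit sigma ord_max.
    apply/eqP; rewrite eq_porbit_mem.
    have : r \in c.
      by rewrite -(mem_map val_inj) (perm_mem pc) mem_iota /= add0n ltn_ord.
    rewrite /c tE -trajectS => /trajectP[i _ ->]; rewrite -permX. exact: mem_porbit.
  apply/cards1P; exists (porbit sigma ord_max); apply/setP => A; rewrite inE.
  apply/imsetP/eqP => [[r _ ->]|->]; [exact: orb|by exists ord_max].
- exact: permutations_uniq.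
rewrite map_inj_in_uniq ?enum_uniq // => s t; rewrite !mem_enum. exact: orbit_list_inj.
Qed.
End Arrangements.

(** * Traces of spectral sums *)

Section Traces.
Variables (R : realType) (n : nat).
Implicit Types (f : seq R -> R) (l : 'rV[R]_n) (hs : seq 'M[R]_n).

Fixpoint path_product hs (a : 'I_n) (t : seq 'I_n) : R :=
  match hs, t with
  | h :: hs', b :: t' => h a b * path_product hs' b t'
  | _, _ => 1
  end.

Lemma eigenproj1 i : eigenproj 1%:M i = delta_mx i i :> 'M[R]_n.
Proof.
apply/matrixP => a b; rewrite eigenprojE !mxE.
by rewrite -natrM mulnb.
Qed.

Lemma big_tuple_cons (T : finType) m (F : seq T -> R) :
  \sum_(u : m.+1.-tuple T) F u = \sum_x \sum_(u : m.-tuple T) F (x :: u).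
Proof.
rewrite pair_big /= (reindex (fun q : T * m.-tuple T => [tuple of q.1 :: q.2])) //.
exists (fun u : m.+1.-tuple T => (thead u, [tuple of behead u])) => [[x u] _|u _].
  by congr pair; apply: val_inj.
by apply: val_inj; rewrite /= [in RHS](tuple_eta u).
Qed.

Lemma delta_mul_entry (N : 'I_n -> 'M[R]_n) a b :
  (\sum_i delta_mx i i *m N i) a b = N a a b.
Proof.
rewrite summxE (bigD1 a) //= big1 => [|i ia].
  rewrite addr0 mxE (bigD1 a) //= mxE !eqxx mul1r big1 ?addr0 // => c ca.
  by rewrite mxE (negbTE ca) andbF mul0r.
by rewrite mxE big1 // => c _; rewrite mxE eq_sym (negbTE ia) mul0r.
Qed.

Lemma big_tuple_nil (T : finType) (F : seq T -> R) :
  \sum_(u : 0.-tuple T) F u = F [::].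
Proof. by rewrite (big_pred1 [tuple]) // => u; apply/esym/eqP; rewrite [u]tuple0. Qed.

Lemma chain1_entry f l hs a b : chain1 f (1%:M, l) hs a b =
  \sum_(t : (size hs).-tuple 'I_n)
     f [seq l 0 i | i <- a :: t] * path_product hs a t * (last a t == b)%:R.
Proof.
elim: hs f a => [|h hs IH] f a.
  rewrite /chain1 /= mul1mx.
  under eq_bigr do rewrite eigenproj1.
  rewrite delta_mul_entry mxE (big_tuple_nil (fun t => f [seq l 0 i | i <- a :: t] *
    path_product [::] a t * (last a t == b)%:R)) /=.
  by rewrite mulr1 mulr_natr.
rewrite chain1_cons.
under eq_bigr do rewrite eigenproj1 -mulmxA.
rewrite delta_mul_entry mxE (big_tuple_cons _ (fun t => f [seq l 0 i | i <- a :: t] *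
    path_product (h :: hs) a t * (last a t == b)%:R)) /=.
apply: eq_bigr => c _; rewrite IH mulr_sumr; apply: eq_bigr => t _ /=.
by ring.
Qed.

Definition loop_product hs h (u : seq 'I_n) : R :=
  if u is a :: t then path_product hs a t * h (last a t) a else 0.

Lemma trace_chain1 f l hs h : \tr (chain1 f (1%:M, l) hs *m h) =
  \sum_(u : (size hs).+1.-tuple 'I_n) f [seq l 0 i | i <- u] * loop_product hs h u.
Proof.
rewrite (big_tuple_cons _ (fun u => f [seq l 0 i | i <- u] * loop_product hs h u)).
rewrite /mxtrace; apply: eq_bigr => a _; rewrite mxE.
under eq_bigr do rewrite chain1_entry mulr_suml.
rewrite exchange_big; apply: eq_bigr => t _ /=.
rewrite (bigD1 (last a t)) //= eqxx big1 => [|b bt]; last first.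
  by rewrite eq_sym (negbTE bt) mulr0 mul0r.
by rewrite addr0 mulr1 mulrA.
Qed.
End Traces.

Section CycleTrace.
Variables (R : realType) (n k : nat).
Implicit Types (f : seq R -> R) (l : 'rV[R]_n) (H : 'I_k.+1 -> 'M[R]_n).

Lemma path_product_traject (sigma : 'S_k.+1) H (p : 'I_k.+1 -> 'I_n) x m :
  path_product [seq H r | r <- traject sigma x m] (p x) [seq p r | r <- traject sigma (sigma x) m] =
  \prod_(r <- traject sigma x m) H r (p r) (p (sigma r)).
Proof. by elim: m x => [|m IH] x; rewrite /= ?big_nil // big_cons IH. Qed.

Lemma sum_ffun_tuple (F : seq 'I_n -> R) (s : seq 'I_k.+1) : perm_eq s (enum 'I_k.+1) ->
  \sum_(p : {ffun 'I_k.+1 -> 'I_n}) F [seq p r | r <- s] =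
  \sum_(u : k.+1.-tuple 'I_n) F u.
Proof.
move=> ps; have szs : size s = k.+1 by rewrite (perm_size ps) size_enum_ord.
have us : uniq s by rewrite (perm_uniq ps) enum_uniq.
have ms r : r \in s by rewrite (perm_mem ps) mem_enum.
have szE (p : {ffun 'I_k.+1 -> 'I_n}) : size [seq p r | r <- s] == k.+1 by rewrite size_map szs.
rewrite [RHS](reindex (fun p : {ffun 'I_k.+1 -> 'I_n} => Tuple (szE p))) //.
exists (fun u : k.+1.-tuple 'I_n => [ffun r => nth (thead u) u (index r s)]) => [p _|u _].
  apply/ffunP => r; rewrite ffunE /= (nth_map r) ?index_mem //.
  by rewrite nth_index.
apply: val_inj => /=; apply: (@eq_from_nth _ (thead u)); first by rewrite size_map size_tuple.
move=> i; rewrite size_map => is_; rewrite (nth_map ord_max) // ffunE index_uniq //.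
Qed.

(** A choice [p] of an eigenvalue index for every point of the cycle is a closed path
    of matrix indices; following the cycle lists its vertices in the order in which
    the trace visits them. *)
Lemma cycle_trace (sigma : 'S_k.+1) f l H : one_cycle sigma ->
  (forall s t, perm_eq s t -> f s = f t) ->
  \sum_(p : {ffun 'I_k.+1 -> 'I_n}) f [seq l 0 (p r) | r <- enum 'I_k.+1] *
     \prod_r H r (p r) (p (sigma r)) =
  \tr (chain1 f (1%:M, l) [seq H r | r <- traject sigma (sigma ord_max) k] *m H ord_max).
Proof.
move=> /one_cycleP[ps it_] fperm; rewrite trace_chain1 size_map size_traject.
set x := sigma ord_max; set c := traject sigma x k.+1.
have itx : iter k sigma x = ord_max by rewrite /x -iterSr.
have pc : perm_eq c (enum 'I_k.+1).
  apply: perm_trans ps; rewrite /c trajectSr itx perm_rcons.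
  by rewrite /x.
rewrite -(sum_ffun_tuple (fun u => f [seq l 0 i | i <- u] * loop_product _ _ u) pc).
apply: eq_bigr => p _; congr (_ * _).
  apply: fperm; rewrite -map_comp; apply: perm_map; rewrite perm_sym; exact: pc.
rewrite -big_enum -(perm_big _ pc) /=.
have cE : c = rcons (traject sigma x k) ord_max by rewrite /c trajectSr itx.
rewrite {1}cE big_rcons /= last_map last_traject itx path_product_traject -/x.
by rewrite mulrC.
Qed.
End CycleTrace.

(** * The cyclic tensor form as a trace *)

Section CyclicForm.
Variables (R : realType) (n k : nat).
Implicit Types (V : 'M[R]_n) (K : 'I_k.+1 -> 'M[R]_n) (f : seq R -> R) (l : 'rV[R]_n).

(** Both sides distribute the products of the entries of [V^T *m K r *m V]. *)
Lemma tensor2_form_conj V (T : tensor2 R n k.+1) K :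
  tensor2_form (conj_tensor2 V T) K =
  tensor2_form T (fun r => V^T *m K r *m V).
Proof.
rewrite /tensor2_form /conj_tensor2.
pose F (i j p q : {ffun 'I_k.+1 -> 'I_n}) := T p q * (\prod_(r < k.+1) V (i r) (p r)) *
  (\prod_(r < k.+1) V (j r) (q r)) * \prod_(r < k.+1) K r (i r) (j r).
transitivity (\sum_i \sum_j \sum_p \sum_q F i j p q).
  apply: eq_bigr => i _; apply: eq_bigr => j _; rewrite mulr_suml.
  by apply: eq_bigr => p _; rewrite mulr_suml.
under eq_bigr => i _ do rewrite exchange_big.
rewrite exchange_big /=; apply: eq_bigr => p _.
under eq_bigr => i _ do rewrite exchange_big.
rewrite exchange_big /=; apply: eq_bigr => q _.
have entry r : (V^T *m K r *m V) (p r) (q r) =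
    \sum_a \sum_b V a (p r) * V b (q r) * K r a b.
  rewrite mxE exchange_big; apply: eq_bigr => b _; rewrite mxE mulr_suml.
  by apply: eq_bigr => a _; rewrite mxE; ring.
under [X in _ = _ * X]eq_bigr do rewrite entry.
rewrite bigA_distr_bigA mulr_sumr; apply: eq_bigr => i _.
rewrite bigA_distr_bigA mulr_sumr; apply: eq_bigr => j _.
by rewrite /F !big_split /=; ring.
Qed.

(** For each permutation one lower index matches the upper index [p], namely [p]
    composed with the inverse permutation; inversion preserves the cycles. *)
Lemma tensor2_form_sum_cycles (T : tensor R n k.+1) K :
  tensor2_form (sum_cycles T) K =
  \sum_(sigma : 'S_k.+1 | one_cycle sigma) \sum_(p : {ffun 'I_k.+1 -> 'I_n})
     T p * \prod_r K r (p r) (p (sigma r)).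
Proof.
have onecV (sigma : 'S_k.+1) : one_cycle (sigma^-1)%g = one_cycle sigma.
  by rewrite /one_cycle porbitsV.
rewrite [RHS](reindex_inj invg_inj) /=.
under [RHS]eq_bigl do rewrite onecV.
rewrite exchange_big /tensor2_form; apply: eq_bigr => p _.
under [LHS]eq_bigr do rewrite /sum_cycles mulr_suml.
rewrite exchange_big; apply: eq_bigr => sigma _ /=.
pose q0 : {ffun 'I_k.+1 -> 'I_n} := [ffun r => p ((sigma^-1)%g r)].
rewrite (bigD1 q0) //= [X in _ + X]big1 => [|q qq0]; rewrite /Diag_perm.
  rewrite ifT; last by apply/forallP => r; rewrite ffunE permK.
  by rewrite addr0; congr (_ * _); apply: eq_bigr => r _; rewrite ffunE.
rewrite ifF ?mul0r //; apply: contraNF qq0 => /forallP H.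
by apply/eqP/ffunP => r; rewrite ffunE; have /eqP -> := H ((sigma^-1)%g r); rewrite permKV.
Qed.

(** Arrangements are lists of natural numbers, so the arguments are indexed by
    natural numbers as well. *)
Definition nat_args j (H : 'I_j -> 'M[R]_n) m : 'M[R]_n :=
  if insub m is Some i then H i else 0.

Lemma nat_argsE j (H : 'I_j -> 'M[R]_n) (i : 'I_j) : nat_args H i = H i.
Proof. by rewrite /nat_args valK. Qed.

Lemma chain1_conj f V l hs : chain1 f (V, l) hs =
  V *m chain1 f (1%:M, l) [seq V^T *m h *m V | h <- hs] *m V^T.
Proof.
have projV i : eigenproj V i = V *m eigenproj 1%:M i *m V^T.
  by rewrite /eigenproj !colE mul1mx trmx_mul !mulmxA.
elim: hs f => [|h hs IH] f.
  rewrite /chain1 /= !mul1mx mulmx_sumr mulmx_suml; apply: eq_bigr => i _.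
  by rewrite projV -!mulmxA; congr (_ *m (_ *m _)); rewrite scalar_mxC.
rewrite /= !chain1_cons mulmx_sumr mulmx_suml; apply: eq_bigr => i _ /=.
by rewrite IH projV !mulmxA.
Qed.

Lemma trace_sum_cycles V l f (H : 'I_k.+1 -> 'M[R]_n) :
  (forall s t, perm_eq s t -> f s = f t) ->
  \tr ((\sum_(s <- arrangements k) chain1 f (V, l)
     [seq nat_args (fun i => H (lift ord_max i)) m | m <- s]) *m H ord_max) =
  tensor2_form (conj_tensor2 V (sum_cycles (fun p => f [seq l 0 (p r) | r <- enum 'I_k.+1]))) H.
Proof.
move=> fperm; rewrite tensor2_form_conj tensor2_form_sum_cycles.
rewrite -(perm_big _ (orbit_list_perm k)) big_map big_enum /=.
rewrite mulmx_suml raddf_sum /=; apply: eq_bigr => sigma sc.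
rewrite cycle_trace // chain1_conj.
have trV (A B : 'M[R]_n) : \tr (V *m A *m V^T *m B) = \tr (A *m (V^T *m B *m V)).
  by rewrite -!mulmxA mxtrace_mulC !mulmxA.
rewrite trV; have [ps _] := one_cycleP sc.
congr (\tr (chain1 _ _ _ *m _)); rewrite -!map_comp; apply/eq_in_map => r rt /=.
suff -> : nat_args (fun i : 'I_k => H (lift ord_max i)) r = H r by [].
have rk : (r < k)%N.
  have := perm_iota_rcons ps; move=> /perm_mem/(_ (val r)).
  by rewrite (mem_map val_inj) rt mem_iota /= add0n => /esym.
rewrite -[nat_of_ord r]/(nat_of_ord (Ordinal rk)) nat_argsE; congr H.
by apply: val_inj; exact: lift_max.
Qed.
End CyclicForm.

(** * The derivatives of a spectral function *)

Section LocalContinuity.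
Variables (R : realType) (n : nat) (I : set R).
Implicit Types (f : seq R -> R) (Y Z : 'M[R]_n) (D : spectral_data R n).
Implicit Types (w : seq ('M[R]_n * (spectral_data R n * spectral_data R n))).

Definition data_of Y : spectral_data R n := (eigbasis Y, eigvals Y).

Lemma data_of_mx Y : sym_mx Y -> spectral_mx (data_of Y) = Y.
Proof. by move=> /eigbasisP[_ E]; rewrite /spectral_mx -E. Qed.

Lemma data_of_in Y : sym_spectrum_in I Y -> spectral_in I (data_of Y).
Proof. by case=> /eigbasisP[oY _] IY. Qed.

Definition continuous_on_nodes f m := forall s e, size s = m -> nodes_in I s -> 0 < e ->
  exists2 r, 0 < r & forall t, nodes_in I t -> near_nodes r t s -> `|f t - f s| < e.

Lemma finite_common_radius (T : finType) (Q : T -> R -> Prop) :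
  (forall x, exists2 r, 0 < r & Q x r) ->
  (forall x r r', r' <= r -> Q x r -> Q x r') ->
  exists2 r, 0 < r & forall x, Q x r.
Proof.
move=> H mono; have [x|rad radP] := @choice T R (fun x r => 0 < r /\ Q x r).
  by have [r r0 Qr] := H x; exists r.
exists (\big[Order.min/1]_x rad x).
  by apply: lt_bigmin => // x _; case: (radP x).
move=> x; have [_] := radP x; apply: mono; exact: bigmin_le.
Qed.

Lemma data_in_left (S : set R) w : (forall x, x \in w -> spectral_in S x.2.1) ->
  data_in S (left_data w).
Proof.
elim: w => //= x w IH H; split; first by apply: H; rewrite mem_head.
by apply: IH => y yw; apply: H; rewrite inE yw orbT.
Qed.

Lemma data_in_right (S : set R) w : (forall x, x \in w -> spectral_in S x.2.2) ->
  data_in S (right_data w).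
Proof.
elim: w => //= x w IH H; split; first by apply: H; rewrite mem_head.
by apply: IH => y yw; apply: H; rewrite inE yw orbT.
Qed.

Lemma near_grid (mu : 'I_n -> R) r t :
  nodes_in [set x | exists i, `|x - mu i| < r] t ->
  exists u : seq 'I_n, near_nodes r t [seq mu i | i <- u].
Proof.
elim: t => [|x t IH]; first by exists [::].
move=> /nodes_in_cons[[i xi] /IH[u tu]]; exists (i :: u); by rewrite /= xi.
Qed.

(** The eigenvalues of the matrices near [Y] lie close to the finite spectrum of [Y].
    Since the tuples of eigenvalues of [Y] are finite in number, [f] has a common
    bound and a common modulus of continuity near all of them. *)
Lemma chain_continuous f m Y e : continuous_on_nodes f m -> sym_spectrum_in I Y -> 0 < e ->
  exists2 delta, 0 < delta & forall w, size w = m ->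
    (forall x, x \in w -> [/\ x.2.2 = data_of Y, spectral_in I x.2.1 &
       `|spectral_mx x.2.1 - Y| < delta]) ->
    `|chain f (left_data w) - chain f (right_data w)| <= e * \prod_(x <- w) `|x.1|.
Proof.
move=> fc DY e0; have [K K0 KP] := chain_uniformly_continuous R n m.
have sY := data_of_mx DY.1; have [oY IY] := data_of_in DY.
pose mu := eigvals Y 0.
have uniform eta : 0 < eta -> exists2 r, 0 < r & forall (u : m.-tuple 'I_n) t, nodes_in I t ->
    near_nodes r t [seq mu i | i <- u] -> `|f t - f [seq mu i | i <- u]| < eta.
  move=> eta0; apply: finite_common_radius => [u|u r r' rr' H t It tu].
    apply: fc => //; first by rewrite size_map size_tuple.
    by move=> _ /mapP[i _ ->]; exact: IY.
  by apply: H => //; apply: near_nodes_le tu.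
(* [kappa] bounds both [eta] and [B * theta], so that [K] times their sum is at
   most [e]. *)
pose kappa := e / (2 * (K + 1)).
have K1 : 0 < K + 1 by rewrite ltr_wpDl.
have kappa0 : 0 < kappa by rewrite divr_gt0 // mulr_gt0.
have [rk rk0 rkP] := uniform kappa kappa0.
have [r1 r10 r1P] := uniform 1 ltr01.
pose B := 1 + \sum_(u : m.-tuple 'I_n) `|f [seq mu i | i <- u]|.
have fB (u : m.-tuple 'I_n) : 1 + `|f [seq mu i | i <- u]| <= B.
  by rewrite lerD2l (bigD1 u) //= lerDl sumr_ge0.
have B0 : 0 <= B by rewrite addr_ge0 // sumr_ge0.
have B1 : 0 < B + 1 by rewrite ltr_wpDl.
pose theta := Num.min rk (kappa / (B + 1)).
have theta0 : 0 < theta by rewrite lt_min rk0 divr_gt0.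
have n4 : 0 < (n%:R ^+ 4 + 1 : R) by rewrite ltr_wpDl ?exprn_ge0.
(* The second bound keeps the eigenvalues within [r1] of the spectrum of [Y], where
   [B] bounds [f]. *)
exists (Num.min (theta ^+ 2) (r1 / (n%:R ^+ 4 + 1))).
  by rewrite lt_min exprn_gt0 // divr_gt0.
move=> w szw wP.
pose S := [set x | I x /\ exists i, `|x - mu i| < r1].
pose S' := [set x | exists i, x = mu i].
have S'S x : S' x -> S x.
  by case=> i ->; split; [exact: IY|exists i; rewrite subrr normr0].
have lS x : x \in w -> spectral_in S x.2.1.
  move=> /wP[_ [ox Ix]]; rewrite lt_min => /andP[_ xY]; split=> // i; split; first exact: Ix.
  apply: (@spectrum_close _ _ x.2.1 (data_of Y)) => //; rewrite sY.
  move: xY; rewrite ltr_pdivlMr // mulrC; apply: le_lt_trans.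
  by rewrite ler_wpM2r // lerDl.
have rS x : x \in w -> spectral_in S' x.2.2.
  by move=> /wP[-> _ _]; split=> // i; exists i.
have fS t : size t = m -> nodes_in S t -> `|f t| <= B.
  move=> szt St; have [|u tu] := @near_grid mu r1 t; first by move=> x /St[].
  have szu : size u == m by rewrite -szt (near_nodes_size tu) size_map.
  apply: le_trans (fB (Tuple szu)).
  have := r1P (Tuple szu) t; move=> /(_ _ tu) H.
  rewrite -[f t](subrK (f [seq mu i | i <- u])) (le_trans (ler_normD _ _)) // lerD2r.
  by rewrite ltW // H // => x /St[].
have KE : K * (kappa + B * theta) <= e.
  have : B * theta <= kappa.
    rewrite (@le_trans _ _ (B * (kappa / (B + 1)))) //.
      by rewrite ler_wpM2l // ge_min lexx orbT.
    rewrite mulrCA ler_piMr ?(ltW kappa0) // ler_pdivrMr // mul1r lerDl //.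
  move=> H; apply: (@le_trans _ _ (K * (kappa + kappa))); first by rewrite ler_wpM2l // lerD2l.
  have -> : e = (K + 1) * (kappa + kappa).
    rewrite /kappa; field; exact: lt0r_neq0.
  by rewrite ler_wpM2r ?addr_ge0 ?(ltW kappa0) // lerDl.
apply: (@le_trans _ _ (K * (kappa + B * theta) * \prod_(x <- w) `|x.1|)); last first.
  by rewrite ler_wpM2r // prodr_ge0.
apply: (KP w f f S S') => //.
- exact: ltW.
- exact: data_in_left.
- exact: data_in_right.
- by move=> x /wP[-> _]; rewrite sY lt_min => /andP[/ltW].
- by move=> t szt St; apply: fS => // x /St/S'S.
move=> t t' szt St St' tt'.
have [u t'u] : exists u : seq 'I_n, t' = [seq mu i | i <- u].
  elim: (t') St' => [|x s IH]; first by exists [::].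
  by move=> /nodes_in_cons[[i ->] /IH[u ->]]; exists (i :: u).
have szu : size u == m by rewrite -szt (near_nodes_size tt') t'u size_map.
rewrite t'u ltW // (rkP (Tuple szu)) //; first by move=> x /St[].
by rewrite -t'u; apply: near_nodes_le tt'; rewrite ge_min lexx.
Qed.
End LocalContinuity.

Section SpectralDerivative.
Variables (R : realType) (n : nat).
Implicit Types (f : seq R -> R) (Y Z : 'M[R]_n).

(** Every order in which the directions can be inserted between the spectral
    projections contributes one spectral sum. *)
Definition spectral_derivative f j Y (H : 'I_j -> 'M[R]_n) : 'M[R]_n :=
  \sum_(s <- arrangements j) chain1 f (data_of Y) [seq nat_args H m | m <- s].

Lemma nat_args_sym j (H : 'I_j -> 'M[R]_n) m : (forall i, sym_mx (H i)) -> sym_mx (nat_args H m).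
Proof.
by move=> sH; rewrite /nat_args; case: insubP => [i _ _|_] //; rewrite /sym_mx trmx0.
Qed.

Lemma nat_args_extend j (H : 'I_j -> 'M[R]_n) Z m : (m < j)%N ->
  nat_args (extend_args H Z) m = nat_args H m.
Proof.
move=> mj; have mj1 : (m < j.+1)%N by apply: ltnW.
rewrite -[m]/(nat_of_ord (Ordinal mj)) nat_argsE.
rewrite -[nat_of_ord (Ordinal mj)]/(nat_of_ord (Ordinal mj1)) nat_argsE /extend_args.
case: unliftP => [i E|E]; last first.
  by have := congr1 val E; rewrite /= => E'; exfalso; have := mj; rewrite E' ltnn.
congr H; apply: val_inj; have := congr1 val E; rewrite /= => ->.
by rewrite /bump leqNgt ltn_ord.
Qed.

Lemma nat_args_extend_last j (H : 'I_j -> 'M[R]_n) Z :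
  nat_args (extend_args H Z) j = Z.
Proof.
rewrite -[j]/(nat_of_ord (@ord_max j)) nat_argsE /extend_args.
by rewrite unlift_none.
Qed.

Lemma prod_nat_args j (H : 'I_j -> 'M[R]_n) s : s \in arrangements j ->
  \prod_(h <- [seq nat_args H m | m <- s]) `|h| = \prod_(i < j) `|H i|.
Proof.
rewrite mem_permutations big_map => ps; rewrite (perm_big _ ps) /=.
rewrite -{1}[j]subn0 -/(index_iota 0 j) big_mkord.
by apply: eq_bigr => i _; rewrite nat_argsE.
Qed.

Lemma norm1_mx_le1 : `|1%:M : 'M[R]_n| <= 1.
Proof. by have := scalar_mx_norm n (1 : R); rewrite normr1. Qed.

(** An arrangement uses each argument once, hence linearly. *)
Lemma chain1_linear_arg j f D (H : 'I_j -> 'M[R]_n) (i : 'I_j) a (A B : 'M[R]_n) s h0 :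
  uniq s -> (nat_of_ord i) \in s ->
  let C A := chain f ((h0, D) :: [seq (nat_args [eta H with i |-> A] m, D) | m <- s]) in
  C (a *: A + B) = a *: C A + C B.
Proof.
have argsE A' m : nat_args [eta H with i |-> A'] m = if m == i then A' else nat_args H m.
  rewrite /nat_args; case: insubP => [l lj lm|].
    by rewrite /= -lm.
  move=> mj; case: eqP => // E; by rewrite E ltn_ord in mj.
have same A' s' : nat_of_ord i \notin s' ->
    [seq (nat_args [eta H with i |-> A'] m, D) | m <- s'] = [seq (nat_args H m, D) | m <- s'].
  move=> is'; apply/eq_in_map => m ms'; rewrite argsE ifF //.
  by apply: contraNF is' => /eqP <-.
elim: s f h0 => [//|m s IH] f h0 /= /andP[ms us]; rewrite inE.
have [mi _|mi] := eqVneq (nat_of_ord i) m.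
  rewrite !argsE -mi eqxx !same ?mi // scalemxAr -mulmxDr; congr (_ *m _).
  rewrite scaler_sumr -big_split; apply: eq_bigr => l _ /=.
  by rewrite scalemxAr -mulmxDr mulmxDl scalemxAl.
rewrite /= => is_; rewrite scalemxAr -mulmxDr; congr (_ *m _).
rewrite scaler_sumr -big_split; apply: eq_bigr => l _ /=.
rewrite scalemxAr -mulmxDr; congr (_ *m _).
have := IH (fun t => f (D.2 0 l :: t)) (nat_args H m) us is_.
by rewrite /= !argsE eq_sym (negbTE mi).
Qed.

(** Transposition reverses the order of the arguments, which permutes the
    arrangements. *)
Lemma spectral_derivative_multilinear f j Y : (forall s t, perm_eq s t -> f s = f t) ->
  sym_multilinear (spectral_derivative f (j := j) Y).
Proof.
move=> fperm; split=> [H sH|H i a A B sH sA sB].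
  rewrite /sym_mx /spectral_derivative linear_sum /=.
  under eq_bigr => s _.
    rewrite trmx_chain1; last by move=> _ /mapP[m _ ->]; exact: nat_args_sym.
    rewrite (_ : (fun t => f (rev t)) = f); last first.
      by apply/funext => t; apply: fperm; rewrite perm_rev.
    rewrite -map_rev; over.
  rewrite -(big_map rev xpredT (fun s => chain1 f (data_of Y) [seq nat_args H m | m <- s])).
  apply: perm_big; apply: uniq_perm; last first.
  - move=> s; rewrite -[s in LHS]revK (mem_map (can_inj revK)).
    by rewrite !mem_permutations perm_rev.
  - exact: permutations_uniq.
  by rewrite (map_inj_uniq (can_inj revK)) permutations_uniq.
rewrite /spectral_derivative scaler_sumr -big_split big_seq [RHS]big_seq /=.
apply: eq_bigr => s /arrangementP[us _ js].
have is_ : nat_of_ord i \in s by rewrite js.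
have := chain1_linear_arg f (data_of Y) H a A B 1%:M us is_.
by rewrite /chain1 -!map_comp.
Qed.

Lemma spectral_derivative0 f Y (g : R -> R) H :
  (forall i, f [:: eigvals Y 0 i] = g (eigvals Y 0 i)) ->
  spectral_derivative f (j := 0) Y H = matrix_fun g Y.
Proof.
move=> fg; rewrite /spectral_derivative /arrangements /= big_seq1 /chain1 /= mul1mx.
have -> : matrix_fun g Y = spectral_mx (eigbasis Y, map_mx g (eigvals Y)) by [].
rewrite spectral_mxE; apply: eq_bigr => i _ /=.
by rewrite mul_mx_scalar fg mxE.
Qed.

Lemma sum_le_share (T : eqType) (s : seq T) (F : T -> R) e P : 0 < e -> 0 <= P ->
  (forall x, x \in s -> F x <= e / ((size s)%:R + 1) * P) -> \sum_(x <- s) F x <= e * P.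
Proof.
move=> e0 P0 FP; rewrite big_seq.
apply: (@le_trans _ _ (\sum_(x <- s | x \in s) e / ((size s)%:R + 1) * P)); first exact: ler_sum.
rewrite -big_seq big_const_seq count_predT iter_addr_0 -[leLHS]mulr_natl mulrA.
rewrite ler_wpM2r // mulrCA ler_piMr ?(ltW e0) // ler_pdivrMr ?mul1r ?lerDl //.
Qed.

Lemma spectral_derivative_continuous (I : set R) f j Y : continuous_on_nodes I f j.+1 ->
  sym_spectrum_in I Y -> continuous_within (sym_spectrum_in I) (spectral_derivative f (j := j)) Y.
Proof.
move=> fc DY e e0; pose N := size (arrangements j).
have e1 : 0 < e / (N%:R + 1) by rewrite divr_gt0 // ltr_wpDl.
have [delta delta0 dP] := chain_continuous fc DY e1.
apply/near_within_ballP; exists delta => // Z DZ ZY H sH.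
rewrite /spectral_derivative -sumrB (le_trans (ler_norm_sum _ _ _)) //.
apply: sum_le_share => //; first exact: prodr_ge0.
move=> s sj; have [_ szs _] := arrangementP sj.
pose w := [seq (h, (data_of Z, data_of Y)) | h <- 1%:M :: [seq nat_args H m | m <- s]].
have szw : size w = j.+1 by rewrite /w size_map /= size_map szs.
have HZ : `|spectral_mx (data_of Z) - Y| < delta by rewrite data_of_mx //; case: DZ.
have wP x : x \in w -> [/\ x.2.2 = data_of Y, spectral_in I x.2.1 &
       `|spectral_mx x.2.1 - Y| < delta].
  by move=> /mapP[h _ ->]; exact: (And3 erefl (data_of_in DZ) HZ).
have := dP w szw wP.
have -> : left_data w = (1%:M, data_of Z) ::
    [seq (h, data_of Z) | h <- [seq nat_args H m | m <- s]].
  by rewrite /left_data /w /= -!map_comp.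
have -> : right_data w = (1%:M, data_of Y) ::
    [seq (h, data_of Y) | h <- [seq nat_args H m | m <- s]].
  by rewrite /right_data /w /= -!map_comp.
move=> /le_trans; apply; rewrite ler_wpM2l ?(ltW e1) // /w big_map big_cons /=.
by rewrite (prod_nat_args H sj) ler_piMl ?prodr_ge0 ?norm1_mx_le1.
Qed.

(** The increment of [spectral_derivative f] telescopes into spectral sums of [psi]
    with [Z - Y] inserted at every position of every arrangement; the arrangements of
    one more argument are exactly these insertions. Corresponding summands of the
    increment and of the derivative differ only by [Y] in place of [Z] in some slots,
    so continuity of the spectral sums bounds the error. *)
Lemma spectral_derivative_frechet (I : set R) f psi j Y :
  continuous_on_nodes I psi j.+2 ->
  (forall s1 x x' s2, (size s1 + size s2)%N = j -> nodes_in I s1 -> I x -> I x' -> nodes_in I s2 ->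
    f (s1 ++ x :: s2) - f (s1 ++ x' :: s2) = (x - x') * psi (s1 ++ x :: x' :: s2)) ->
  sym_spectrum_in I Y ->
  frechet_within (sym_spectrum_in I) (spectral_derivative f (j := j)) Y
    (spectral_derivative psi (j := j.+1) Y).
Proof.
move=> fc dd DY e e0.
pose pairs := [seq (s, m) | s <- arrangements j, m <- iota 0 j.+1].
pose N := size pairs.
have e1 : 0 < e / (N%:R + 1) by rewrite divr_gt0 // ltr_wpDl.
have [delta delta0 dP] := chain_continuous fc DY e1.
apply/near_within_ballP; exists delta => // Z DZ ZY H sH.
have sZ := data_of_mx DZ.1; have sY := data_of_mx DY.1.
pose hs s := [seq nat_args H m | m <- s].
pose w s m := [seq (h, (data_of Z, data_of Y)) | h <- 1%:M :: take m (hs s)] ++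
  (Z - Y, (data_of Y, data_of Y)) :: [seq (h, (data_of Y, data_of Y)) | h <- drop m (hs s)].
have sumE (F : nat -> 'M[R]_n) : \sum_(m <- iota 0 j.+1) F m = \sum_(m < j.+1) F m.
  by rewrite -(big_mkord xpredT F) /index_iota subn0.
have step s : s \in arrangements j -> chain1 f (data_of Z) (hs s) - chain1 f (data_of Y) (hs s) =
    \sum_(m <- iota 0 j.+1) chain psi (left_data (w s m)).
  move=> /arrangementP[_ szs _].
  have := @chain_telescope _ _ I f psi (1%:M :: hs s) _ _ (data_of_in DZ) (data_of_in DY).
  rewrite sZ sY /= size_map szs => -> .
    rewrite sumE; apply: eq_bigr => m _.
    by rewrite /left_data /w map_cat /= -!map_comp.
  by move=> t1 x x' t2 It1 Ix Ix' It2 [sz]; apply: dd.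
have stepY : spectral_derivative psi Y (extend_args H (Z - Y)) =
    \sum_(s <- arrangements j) \sum_(m <- iota 0 j.+1) chain psi (right_data (w s m)).
  rewrite /spectral_derivative (perm_big _ (arrangementsS j)) big_allpairs_dep /=.
  rewrite big_seq [RHS]big_seq; apply: eq_bigr => s /arrangementP[_ _ js].
  apply: eq_bigr => m _.
  have argsE s' : {subset s' <= s} ->
      [seq nat_args (extend_args H (Z - Y)) m | m <- s'] = hs s'.
    by move=> s's; apply/eq_in_map => i /s's; rewrite js; exact: nat_args_extend.
  rewrite /insert_at map_cat /= nat_args_extend_last !argsE; last 2 first.
    by move=> i /mem_drop.
    by move=> i /mem_take.
  rewrite /chain1 /right_data /w !map_cat /= -!map_comp /hs -map_take -map_drop.
  by rewrite -!map_comp.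
have -> : spectral_derivative f Z H - spectral_derivative f Y H -
    spectral_derivative psi Y (extend_args H (Z - Y)) =
    \sum_(x <- pairs) (chain psi (left_data (w x.1 x.2)) - chain psi (right_data (w x.1 x.2))).
  rewrite stepY /spectral_derivative -!sumrB big_allpairs_dep /= big_seq [RHS]big_seq.
  by apply: eq_bigr => s sj; rewrite step // -sumrB.
rewrite -mulrA (le_trans (ler_norm_sum _ _ _)) //.
apply: sum_le_share => //; first by rewrite mulr_ge0 // prodr_ge0.
move=> _ /allpairsP[[s m] [sj mj ->]] /=.
have [_ szs _] := arrangementP sj.
have szw : size (w s m) = j.+2.
  rewrite /w size_cat /= !size_map size_take_min size_drop size_map szs.
  move: mj; rewrite mem_iota ltnS /= => mj; rewrite (minn_idPl mj).
  by rewrite addnS addSn subnKC.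
have HY : `|spectral_mx (data_of Y) - Y| < delta by rewrite sY subrr normr0.
have HZ : `|spectral_mx (data_of Z) - Y| < delta by rewrite sZ.
have wP x : x \in w s m -> [/\ x.2.2 = data_of Y, spectral_in I x.2.1 &
       `|spectral_mx x.2.1 - Y| < delta].
  rewrite mem_cat => /orP[/mapP[h _ ->]|]; first exact: (And3 erefl (data_of_in DZ) HZ).
  rewrite inE => /orP[/eqP ->|/mapP[h _ ->]]; exact: (And3 erefl (data_of_in DY) HY).
apply: (le_trans (dP _ szw wP)); rewrite ler_wpM2l ?(ltW e1) //.
rewrite /w big_cat big_cons big_map big_cons /= [\prod_(x <- [seq _ | h <- drop _ _]) _]big_map /=.
set z := `|Z - Y|; set p1 := \prod_(h <- take m _) _; set p2 := \prod_(h <- drop m _) _.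
have <- : p1 * p2 = \prod_(i < j) `|H i|.
  by rewrite /p1 /p2 -big_cat cat_take_drop prod_nat_args.
have -> : `|1%:M : 'M[R]_n| * p1 * (z * p2) = `|1%:M : 'M[R]_n| * (z * (p1 * p2)) by ring.
have p10 : 0 <= p1 by apply: prodr_ge0.
have p20 : 0 <= p2 by apply: prodr_ge0.
by apply: ler_piMl; [rewrite /z !mulr_ge0|exact: norm1_mx_le1].
Qed.
End SpectralDerivative.

(** * Uniqueness of the derivatives *)

Section Domain.
Variables (R : realType) (n : nat) (I : set R).
Hypothesis iI : is_interval I.
Implicit Types (W X Y Z K : 'M[R]_n).

Lemma interval_convex_sum m (a mu : 'I_m -> R) : (forall j, I (mu j)) ->
  (forall j, 0 <= a j) -> \sum_j a j = 1 -> I (\sum_j a j * mu j).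
Proof.
case: m a mu => [|m] a mu Imu a0 a1.
  by move: a1; rewrite big_ord0 => /eqP; rewrite eq_sym oner_eq0.
have [lo _ loP] := @Order.TotalTheory.arg_minP _ _ 'I_m.+1 ord0 xpredT mu isT.
have [hi _ hiP] := @Order.TotalTheory.arg_maxP _ _ 'I_m.+1 ord0 xpredT mu isT.
apply: (iI (Imu lo) (Imu hi)); apply/andP; split.
  rewrite -[mu lo]mul1r -a1 mulr_suml; apply: ler_sum => j _.
  by rewrite ler_wpM2l // loP.
rewrite -[leRHS]mul1r -a1 mulr_suml; apply: ler_sum => j _.
by apply: ler_wpM2l => //; exact: hiP.
Qed.

Lemma trace_eigenproj_mul U U' i j :
  \tr (eigenproj U i *m eigenproj U' j) = ((U^T *m U' : 'M[R]_n) i j) ^+ 2.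
Proof.
rewrite /mxtrace.
under eq_bigr do rewrite mxE.
under eq_bigr do under eq_bigr do rewrite !eigenprojE.
rewrite mxE expr2 big_distrlr /=; apply: eq_bigr => a _; apply: eq_bigr => b _.
by rewrite !mxE; ring.
Qed.

(** The trace is an average of the eigenvalues of [Y], with the squared coordinates of
    a unit vector as weights. *)
Lemma trace_eigenproj_in U Y i : orth_mx U -> sym_spectrum_in I Y ->
  I (\tr (eigenproj U i *m Y)).
Proof.
move=> oU DY; have [oY IY] := data_of_in DY.
rewrite -{1}(data_of_mx DY.1) spectral_mxE mulmx_sumr raddf_sum /=.
under eq_bigr do rewrite -scalemxAr mxtraceZ mulrC.
apply: interval_convex_sum => // [j|]; first by rewrite trace_eigenproj_mul sqr_ge0.
rewrite -raddf_sum -mulmx_sumr /= sum_eigenproj // mulmx1.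
rewrite /eigenproj mxtrace_mulC /mxtrace big_ord1.
have := congr1 (fun M : 'M[R]_n => M i i) (orth_mxC oU); rewrite !mxE eqxx mulr1n => <-.
by apply: eq_bigr => j _; rewrite !mxE.
Qed.

(** The Rayleigh quotient of a unit eigenvector, written as a trace. *)
Lemma eigval_trace Z i : sym_mx Z ->
  eigvals Z 0 i = \tr (eigenproj (eigbasis Z) i *m Z).
Proof.
move=> sZ; have [oZ _] := eigbasisP sZ.
rewrite -{3}(data_of_mx sZ) (eigenproj_spectral (D := data_of Z)) // mxtraceZ /=.
rewrite /eigenproj mxtrace_mulC /mxtrace big_ord1.
have := congr1 (fun M : 'M[R]_n => M i i) (orth_mxC oZ); rewrite !mxE eqxx mulr1n => E.
rewrite -[LHS]mulr1 -[X in _ * X = _]E; congr (_ * _).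
by apply: eq_bigr => j _; rewrite !mxE.
Qed.

(** A Rayleigh quotient is affine in the matrix, so each eigenvalue of a convex
    combination lies between points of [I]. *)
Lemma sym_spectrum_convex Y W t : sym_spectrum_in I Y -> sym_spectrum_in I W ->
  0 <= t <= 1 -> sym_spectrum_in I (Y + t *: (W - Y)).
Proof.
move=> DY DW t01.
have sZ : sym_mx (Y + t *: (W - Y)).
  by rewrite /sym_mx linearD linearZ linearB /= DY.1 DW.1.
split=> // i; rewrite eigval_trace //.
have [oZ _] := eigbasisP sZ; move: (eigbasis _) oZ => U oZ.
rewrite mulmxDr -scalemxAr mulmxBr mxtraceD mxtraceZ linearB /=.
exact: (interval_homothety iI (trace_eigenproj_in i oZ DY) (trace_eigenproj_in i oZ DW) t01).
Qed.

Lemma scalar_neighbourhood : (exists a b, [/\ I a, I b & a < b]) ->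
  exists c r, 0 < r /\ forall K, sym_mx K -> `|K| < r -> sym_spectrum_in I (c%:M + K).
Proof.
move=> [a [b [Ia Ib ab]]]; pose c := (a + b) / 2; pose r := (b - a) / 2.
have r0 : 0 < r by rewrite divr_gt0 // subr_gt0.
have n4 : 0 < (n%:R ^+ 4 + 1 : R) by rewrite ltr_wpDl ?exprn_ge0.
exists c, (r / (n%:R ^+ 4 + 1)); split=> [|K sK Kr]; first exact: divr_gt0.
have sZ : sym_mx (c%:M + K) by rewrite /sym_mx linearD /= tr_scalar_mx sK.
have [oZ _] := eigbasisP sZ.
split=> // i; pose D : spectral_data R n := (1%:M, const_mx c).
have oD : orth_mx D.1 by rewrite /orth_mx trmx1 mulmx1.
have DE : spectral_mx D = c%:M.
  rewrite /spectral_mx /= mul1mx trmx1 mulmx1.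
  by apply/matrixP => p q; rewrite !mxE.
have [|j] := @spectrum_close _ _ (data_of (c%:M + K)) D r i oZ oD r0.
  rewrite DE data_of_mx //; have -> : c%:M + K - c%:M = K by rewrite addrC addKr.
  move: Kr; rewrite ltr_pdivlMr // mulrC; apply: le_lt_trans.
  by rewrite ler_wpM2r // lerDl.
rewrite /= mxE ltr_norml => /andP[h1 h2].
by apply: (iI Ia Ib); move: h1 h2; rewrite /r /c => h1 h2; apply/andP; split; lra.
Qed.
End Domain.

Section Uniqueness.
Variables (R : realType) (n : nat).
Implicit Types (D : set 'M[R]_n) (F : 'M[R]_n -> 'M[R]_n) (W X Y Z K : 'M[R]_n).

Lemma extend_args_sym j (H : 'I_j -> 'M[R]_n) Z : (forall i, sym_mx (H i)) -> sym_mx Z ->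
  forall i, sym_mx (extend_args H Z i).
Proof. by move=> sH sZ i; rewrite /extend_args; case: unlift. Qed.

Lemma extend_args_lift j (H : 'I_j.+1 -> 'M[R]_n) :
  extend_args (fun i => H (lift ord_max i)) (H ord_max) = H.
Proof.
by apply/funext => i; rewrite /extend_args; case: unliftP => [i' ->|->].
Qed.

Lemma sym_multilinear_last j (M : ('I_j.+1 -> 'M[R]_n) -> 'M[R]_n) H a A B :
  sym_multilinear M -> (forall i, sym_mx (H i)) -> sym_mx A -> sym_mx B ->
  M (extend_args H (a *: A + B)) = a *: M (extend_args H A) + M (extend_args H B).
Proof.
move=> [_ lin] sH sA sB.
have extE C : extend_args H C = [eta extend_args H (0 : 'M[R]_n) with ord_max |-> C].
  apply/funext => i; rewrite /extend_args /=; case: unliftP => [i' ->|->].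
    by rewrite eq_sym (negbTE (neq_lift _ _)).
  by rewrite eqxx.
rewrite (extE (a *: A + B)) (extE A) (extE B).
apply: lin => //; apply: extend_args_sym => //.
by rewrite /sym_mx trmx0.
Qed.

Lemma sym_multilinear_last0 j (M : ('I_j.+1 -> 'M[R]_n) -> 'M[R]_n) H :
  sym_multilinear M -> (forall i, sym_mx (H i)) -> M (extend_args H 0) = 0.
Proof.
move=> Mlin sH; have s0 : sym_mx (0 : 'M[R]_n) by rewrite /sym_mx trmx0.
have := sym_multilinear_last 1 Mlin sH s0 s0.
rewrite scaler0 addr0 scale1r => E.
by apply: (addrI (M (extend_args H 0))); rewrite -E addr0.
Qed.

Lemma sym_multilinear_lastZ j (M : ('I_j.+1 -> 'M[R]_n) -> 'M[R]_n) H a A :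
  sym_multilinear M -> (forall i, sym_mx (H i)) -> sym_mx A ->
  M (extend_args H (a *: A)) = a *: M (extend_args H A).
Proof.
move=> Mlin sH sA; have s0 : sym_mx (0 : 'M[R]_n) by rewrite /sym_mx trmx0.
by rewrite -[a *: A]addr0 sym_multilinear_last // sym_multilinear_last0 // addr0.
Qed.

(** A derivative relative to a convex set is determined in the directions that
    point into the set. *)
Lemma frechet_unique_direction D j (P P' : 'M[R]_n -> ('I_j -> 'M[R]_n) -> 'M[R]_n) Y W
    M M' r H : 0 < r ->
  (forall t, 0 <= t <= 1 -> D (Y + t *: (W - Y))) -> sym_mx (W - Y) ->
  (forall Z, D Z -> `|Z - Y| < r -> forall H, (forall i, sym_mx (H i)) -> P Z H = P' Z H) ->
  sym_multilinear M -> sym_multilinear M' ->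
  frechet_within D P Y M -> frechet_within D P' Y M' -> (forall i, sym_mx (H i)) ->
  M (extend_args H (W - Y)) = M' (extend_args H (W - Y)).
Proof.
move=> r0 seg sWY PP' Mlin M'lin PM PM' sH.
set V := W - Y in sWY *; pose p := \prod_(i < j) `|H i|.
have p0 : 0 <= p by apply: prodr_ge0.
have bound e : 0 < e -> `|M (extend_args H V) - M' (extend_args H V)| <= (e + e) * `|V| * p.
  move=> e0; have /near_within_ballP[d1 d10 d1P] := PM e e0.
  have /near_within_ballP[d2 d20 d2P] := PM' e e0.
  have V1 : 0 < `|V| + 1 by rewrite ltr_wpDl.
  pose m := Num.min r (Num.min d1 d2).
  have m0 : 0 < m by rewrite !lt_min r0 d10.
  (* [Z] stays on the segment from [Y] to [W] and within all three radii. *)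
  pose t := Num.min 1 (m / (`|V| + 1)).
  have t0 : 0 < t by rewrite lt_min ltr01 divr_gt0.
  have t01 : 0 <= t <= 1 by rewrite (ltW t0) ge_min lexx.
  have DZ := seg t t01; set Z := Y + t *: V in DZ.
  have ZY : Z - Y = t *: V by rewrite /Z addrC addKr.
  have ZYm : `|Z - Y| < m.
    rewrite ZY normrZ gtr0_norm //.
    apply: (@le_lt_trans _ _ (m / (`|V| + 1) * `|V|)).
      by rewrite ler_wpM2r // ge_min lexx orbT.
    by rewrite mulrAC ltr_pdivrMr // ltr_pM2l // ltrDl.
  move: ZYm; rewrite !lt_min => /and3P[Zr Z1 Z2].
  have DY : D Y by have := seg 0; rewrite scale0r addr0; apply; rewrite lexx ler01.
  have H1 := d1P Z DZ Z1 H sH; have H2 := d2P Z DZ Z2 H sH.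
  move: H1 H2; rewrite -(PP' Z) // -(PP' Y) ?subrr ?normr0 // ZY !sym_multilinear_lastZ //.
  set x := P Z H - P Y H => H1 H2.
  rewrite -(ler_pM2l t0).
  have -> : t * `|M (extend_args H V) - M' (extend_args H V)| =
     `|(x - t *: M' (extend_args H V)) - (x - t *: M (extend_args H V))|.
    rewrite -{1}(gtr0_norm t0) -normrZ scalerBr; congr `|_|.
    by rewrite opprB [RHS]addrC addrA subrK.
  apply: (le_trans (ler_normB _ _)); apply: (le_trans (lerD H2 H1)).
  rewrite normrZ gtr0_norm // -/p le_eqVlt; apply/orP; left; apply/eqP; ring.
apply/eqP; rewrite -subr_eq0 -normr_le0; apply/negPn/negP; rewrite -ltNge.
set q := `|_| in bound * => q0.
have c0 : 0 < `|V| * p + 1 by rewrite ltr_wpDl // mulr_ge0.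
have := bound (q / (4 * (`|V| * p + 1))).
rewrite divr_gt0 ?mulr_gt0 // => /(_ isT).
set e := q / _; pose y := `|V| * p / (`|V| * p + 1).
have -> : (e + e) * `|V| * p = q * y / 2 by rewrite /e /y; field; rewrite lt0r_neq0.
have : q * y <= q by rewrite ler_piMr ?(ltW q0) // ler_pdivrMr // mul1r lerDl.
lra.
Qed.

(** The directions from [Y] to the matrices of the domain span all symmetric matrices,
    since the domain contains a ball around a scalar matrix: a multiple of any
    symmetric [K] is the difference of two such directions. *)
Lemma derivatives_unique (I : set R) F k X P P' : is_interval I ->
  (exists a b, [/\ I a, I b & a < b]) ->
  derivatives_near (sym_spectrum_in I) F k X P -> derivatives_near (sym_spectrum_in I) F k X P' ->
  sym_spectrum_in I X ->
  forall H : 'I_k -> 'M[R]_n, (forall i, sym_mx (H i)) -> P k X H = P' k X H.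
Proof.
move=> iI I_nondeg /near_within_ballP[r1 r10 rP1] /near_within_ballP[r2 r20 rP2] DX.
pose r := Num.min r1 r2; have r0 : 0 < r by rewrite lt_min r10.
have uniq_near j : (j <= k)%N -> forall Y, sym_spectrum_in I Y -> `|Y - X| < r ->
    forall H : 'I_j -> 'M[R]_n, (forall i, sym_mx (H i)) -> P j Y H = P' j Y H.
  elim: j => [_ Y DY|j IH jk Y DY YX H sH].
    rewrite lt_min => /andP[/(rP1 Y DY)[PF _ _ _] /(rP2 Y DY)[P'F _ _ _]] H _.
    by rewrite PF P'F.
  have [Y1 Y2] : `|Y - X| < r1 /\ `|Y - X| < r2 by move: YX; rewrite lt_min => /andP[].
  have [_ /(_ _ jk) Mlin /(_ _ jk) PM _] := rP1 Y DY Y1.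
  have [_ /(_ _ jk) M'lin /(_ _ jk) PM' _] := rP2 Y DY Y2.
  pose H0 i := H (lift ord_max i).
  have sH0 i : sym_mx (H0 i) by exact: sH.
  have dir W : sym_spectrum_in I W ->
      P j.+1 Y (extend_args H0 (W - Y)) = P' j.+1 Y (extend_args H0 (W - Y)).
    move=> DW.
    have rY : 0 < r - `|Y - X| by rewrite subr_gt0.
    apply: (frechet_unique_direction rY _ _ _ Mlin M'lin PM PM' sH0).
    - by move=> t; exact: sym_spectrum_convex.
    - by rewrite /sym_mx linearB /= DW.1 DY.1.
    move=> Z DZ ZY; apply: IH => //; first exact: ltnW.
    by rewrite (le_lt_trans (ler_distD Y _ _)) // -ltrBrDr.
  have [c [rho [rho0 rhoP]]] := @scalar_neighbourhood _ n I iI I_nondeg.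
  rewrite -(extend_args_lift H) -/H0; set K := H ord_max.
  have sK : sym_mx K by exact: sH.
  have K1 : 0 < `|K| + 1 by rewrite ltr_wpDl.
  pose s := rho / (`|K| + 1); have s0 : 0 < s by rewrite divr_gt0.
  have D1 : sym_spectrum_in I (c%:M + s *: K).
    apply: rhoP; first by rewrite /sym_mx linearZ /= sK.
    by rewrite normrZ gtr0_norm // /s mulrAC ltr_pdivrMr // ltr_pM2l // ltrDl.
  have D2 : sym_spectrum_in I (c%:M : 'M[R]_n).
    by have := rhoP 0; rewrite addr0; apply; rewrite ?normr0 // /sym_mx trmx0.
  have sub_sym W : sym_spectrum_in I W -> sym_mx (W - Y).
    by move=> DW; rewrite /sym_mx linearB /= DW.1 DY.1.
  have sKE : s *: K = -1 *: (c%:M - Y) + (c%:M + s *: K - Y).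
    by rewrite scaleN1r opprB [RHS]addrC addrA subrK addrAC subrr add0r.
  have lastE (M : ('I_j.+1 -> 'M[R]_n) -> 'M[R]_n) : sym_multilinear M ->
      s *: M (extend_args H0 K) =
      -1 *: M (extend_args H0 (c%:M - Y)) + M (extend_args H0 (c%:M + s *: K - Y)).
    move=> lin; rewrite -(sym_multilinear_last _ lin sH0 (sub_sym _ D2) (sub_sym _ D1)) -sKE.
    by rewrite sym_multilinear_lastZ.
  apply: (scalerI (lt0r_neq0 s0)).
  by rewrite !lastE // !dir.
by apply: uniq_near => //; rewrite subrr normr0.
Qed.
End Uniqueness.

(** * The formula *)

Section Assembly.
Variables (R : realType) (n k : nat) (I : set R) (g : R -> R) (d : nat -> R -> R).
Hypotheses (iI : is_interval I) (I_nondeg : exists a b, [/\ I a, I b & a < b]).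
Hypotheses (dI : Ck_derivatives I k d) (d0 : forall x, I x -> d 0%N x = g x).

Lemma divdiff_ext_continuous_on_nodes j : (j <= k)%N ->
  continuous_on_nodes I (divdiff_ext I d) j.+1.
Proof. by move=> jk s e szs Is e0; exact: (divdiff_ext_continuous iI I_nondeg dI jk szs Is e0). Qed.

Lemma spectral_derivatives_near (X : 'M[R]_n) :
  derivatives_near (sym_spectrum_in I) (matrix_fun g) k X
    (fun j => spectral_derivative (divdiff_ext I d) (j := j)).
Proof.
apply/near_within_ballP; exists 1 => // Y DY _; split.
- move=> H; apply: spectral_derivative0 => i.
  have Ii : I (eigvals Y 0 i) by case: DY.
  by rewrite (divdiff_ext1 iI I_nondeg dI Ii) d0.
- by move=> j _; apply: spectral_derivative_multilinear; exact: divdiff_ext_perm.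
- move=> j jk; apply: spectral_derivative_frechet => //.
    exact: divdiff_ext_continuous_on_nodes.
  move=> s1 x x' s2 sz Is1 Ix Ix' Is2.
  exact: (divdiff_ext_rec iI I_nondeg dI jk sz Is1 Ix Ix' Is2).
by apply: spectral_derivative_continuous => //; exact: divdiff_ext_continuous_on_nodes.
Qed.

Lemma nabla_spectral_derivative (X : 'M[R]_n) (H : 'I_k -> 'M[R]_n) :
  sym_spectrum_in I X -> (forall i, sym_mx (H i)) ->
  nabla (sym_spectrum_in I) (matrix_fun g) k X H =
  spectral_derivative (divdiff_ext I d) X H.
Proof.
move=> DX sH; rewrite /nabla; have near := spectral_derivatives_near X.
case: xgetP => [M _ [P HP <-]|/(_ (spectral_derivative (divdiff_ext I d) X))].
  exact: (derivatives_unique iI I_nondeg HP near DX sH).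
by case; exists (fun j => spectral_derivative (divdiff_ext I d) (j := j)).
Qed.

Lemma bold_g_divdiff (mu : 'rV[R]_n) : (forall i, I (mu 0 i)) ->
  bold_g I g k mu = fun p => divdiff_ext I d [seq mu 0 (p r) | r <- enum 'I_k.+1].
Proof.
move=> Imu; apply/funext => p; rewrite /bold_g.
rewrite (vandermonde_quotient_ext iI I_nondeg dI d0); last by move=> i; rewrite mxE.
by congr divdiff_ext; apply: eq_map => r; rewrite mxE.
Qed.
End Assembly.

Theorem theorem6p8 (R : realType) (n k : nat) (I : set R) (g : R -> R)
    (X V : 'M[R]_n)
    (hk : (1 <= k)%N)
    (hI : is_interval I)
    (hI_nondegenerate : exists a b, [/\ I a, I b & a < b])
    (hg : Ck_on I k g)
    (hX : sym_mx X)
    (hXI : forall i, I (eigvals X 0 i))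
    (hV : orth_mx V)
    (hXV : X = V *m diag_mx (eigvals X) *m V^T) :
  Ck_at (sym_spectrum_in I) (matrix_fun g) k X /\
  forall H : 'I_k.+1 -> 'M[R]_n, (forall r, sym_mx (H r)) ->
    as_form (nabla (sym_spectrum_in I) (matrix_fun g) k X) H =
    tensor2_form
      (conj_tensor2 V (sum_cycles (bold_g I g k (eigvals X)))) H.
Proof.
have [d dI d0] := Ck_on_derivatives hg.
have DX : sym_spectrum_in I X by [].
split=> [|H sH].
  exists (fun j => spectral_derivative (divdiff_ext I d) (j := j)).
  exact: spectral_derivatives_near.
rewrite /as_form (nabla_spectral_derivative hI hI_nondegenerate dI d0) //.
rewrite (bold_g_divdiff hI hI_nondegenerate dI d0) // (sH ord_max).
rewrite -trace_sum_cycles; last exact: divdiff_ext_perm.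
congr (\tr (_ *m _)); apply: eq_bigr => s _.
have VX : spectral_mx (data_of X) = spectral_mx (V, eigvals X).
  by rewrite data_of_mx // /spectral_mx -hXV.
have IV : spectral_in I (V, eigvals X) by [].
rewrite /chain1.
exact: (chain_basis_independent (divdiff_ext I d)
  (1%:M :: [seq nat_args (fun i => H (lift ord_max i)) m | m <- s]) (data_of_in DX) IV VX).
Qed.
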